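(* Let $k$ be a field of characteristic $p>0$. There exists a direct system $\{X_n\}_{n\in\mathbb{N}}$ of $0$-dimensional $k$-schemes such that for any noetherian local ring $(R,m_R)$ with $pR\neq 0$ and residue field $k=R/m_R$, the schemes $X_n$ do not lift to $R\to k$ for all sufficiently large $n$ (that is, there is $N$, depending on $R$, such that $X_n$ is not liftable to $R\to k$ for every $n\ge N$).
   Context: For a surjective ring homomorphism $R\to k$ onto a field $k$, a $k$-scheme $X$ is said to lift to $R\to k$ if there exist a flat $R$-scheme $\tilde X$ and a closed embedding $X\hookrightarrow\tilde X$ inducing an isomorphism $X\to\tilde X\times_{\operatorname{Spec} R}\operatorname{Spec} k$. A direct system indexed by $\mathbb{N}$ consists of the $k$-schemes $X_n$ together with $k$-morphisms $X_n\to X_{n+1}$. *)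

(* Defs.v *)
(* Rings are [comPzRingType]s: commutative, unital, possibly zero, since sections
   over the empty open set form the zero ring. *)
From HB Require Import structures.
From mathcomp Require Import all_boot all_order all_algebra.
From mathcomp Require Import boolp classical_sets topology.
From mathcomp Require Import ring.

Set Implicit Arguments.
Unset Strict Implicit.
Unset Printing Implicit Defensive.

Import GRing.Theory.
Local Open Scope classical_set_scope.
Local Open Scope ring_scope.

Identity Coercion set_fun : set >-> Funclass.

Definition ideal (A : comPzRingType) (I : set A) : Prop :=
  [/\ I 0, forall x y, I x -> I y -> I (x + y) & forall a x, I x -> I (a * x)].

Definition prime_ideal (A : comPzRingType) (P : set A) : Prop :=
  [/\ ideal P, ~ P 1 & forall x y, P (x * y) -> P x \/ P y].

Definition maximal_ideal (A : comPzRingType) (M : set A) : Prop :=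
  [/\ ideal M, ~ M 1 &
      forall I : set A, ideal I -> ~ I 1 -> M `<=` I -> I = M].

Definition local_ring (A : comPzRingType) : Prop :=
  exists! M : set A, maximal_ideal M.

Definition local_hom (A B : comPzRingType) (f : A -> B) : Prop :=
  forall (MA : set A) (MB : set B),
    maximal_ideal MA -> maximal_ideal MB -> f @^-1` MB = MA.

Definition noetherian (A : comPzRingType) : Prop :=
  forall I : set A, ideal I ->
    exists (n : nat) (g : 'I_n -> A),
      I = [set x | exists c : 'I_n -> A, x = \sum_(i < n) c i * g i].

Definition bilinear_map (A : comPzRingType) (M N T : lmodType A)
    (t : M -> N -> T) : Prop :=
  (forall (a : A) m m' n, t (a *: m + m') n = a *: t m n + t m' n) /\
  (forall (a : A) m n n', t m (a *: n + n') = a *: t m n + t m n').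

Definition is_tensor (A : comPzRingType) (M N T : lmodType A)
    (t : M -> N -> T) : Prop :=
  bilinear_map t /\
  forall (Q : lmodType A) (b : M -> N -> Q), bilinear_map b ->
    exists g : {linear T -> Q}, (forall m n, g (t m n) = b m n) /\
      forall g' : {linear T -> Q}, (forall m n, g' (t m n) = b m n) -> g' =1 g.

(* [M ⊗ -] preserves injections; tensor products are given by their
   universal property, so [g] below is [id_M ⊗ f]. *)
Definition flat_module (A : comPzRingType) (M : lmodType A) : Prop :=
  forall (N' N : lmodType A) (f : {linear N' -> N}), injective f ->
  forall (T' T : lmodType A) (t' : M -> N' -> T') (t : M -> N -> T),
    is_tensor t' -> is_tensor t ->
  forall g : {linear T' -> T}, (forall m n, g (t' m n) = t m (f n)) ->
    injective g.

Definition restrict_scalars (A B : comPzRingType) (f : {rmorphism A -> B}) : Type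
  := B.

Section RestrictScalars.
Variables (A B : comPzRingType) (f : {rmorphism A -> B}).
HB.instance Definition _ := GRing.Zmodule.on (restrict_scalars f).
Let scale (a : A) (b : restrict_scalars f) : restrict_scalars f := f a * (b : B).
Let scaleA a b v : scale a (scale b v) = scale (a * b) v.
Proof. by rewrite /scale rmorphM mulrA. Qed.
Let scale1 : left_id 1 scale.
Proof. by move=> v; rewrite /scale rmorph1 mul1r. Qed.
Let scaleDr : right_distributive scale +%R.
Proof. by move=> a u v; rewrite /scale mulrDr. Qed.
Let scaleDl v : {morph scale^~ v : a b / a + b}.
Proof. by move=> a b; rewrite /scale rmorphD mulrDl. Qed.
HB.instance Definition _ := GRing.Zmodule_isLmodule.Build A (restrict_scalars f)
  scaleA scale1 scaleDr scaleDl.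
End RestrictScalars.

Definition flat_hom (A B : comPzRingType) (f : {rmorphism A -> B}) : Prop :=
  flat_module (restrict_scalars f : lmodType A).

Record setoid_ring : Type := SetoidRing {
  scar :> Type;
  sequ : scar -> scar -> Prop;
  s0 : scar; s1 : scar;
  sopp : scar -> scar;
  sadd : scar -> scar -> scar;
  smul : scar -> scar -> scar;
  sequ_refl : forall x, sequ x x;
  sequ_sym : forall x y, sequ x y -> sequ y x;
  sequ_trans : forall x y z, sequ x y -> sequ y z -> sequ x z;
  sopp_equ : forall x x', sequ x x' -> sequ (sopp x) (sopp x');
  sadd_equ : forall x x' y y', sequ x x' -> sequ y y' ->
    sequ (sadd x y) (sadd x' y');
  smul_equ : forall x x' y y', sequ x x' -> sequ y y' ->
    sequ (smul x y) (smul x' y');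
  saddA : forall x y z, sequ (sadd x (sadd y z)) (sadd (sadd x y) z);
  saddC : forall x y, sequ (sadd x y) (sadd y x);
  sadd0 : forall x, sequ (sadd s0 x) x;
  saddN : forall x, sequ (sadd (sopp x) x) s0;
  smulA : forall x y z, sequ (smul x (smul y z)) (smul (smul x y) z);
  smulC : forall x y, sequ (smul x y) (smul y x);
  smul1 : forall x, sequ (smul s1 x) x;
  smulD : forall x y z,
    sequ (smul (sadd x y) z) (sadd (smul x z) (smul y z))
}.

(* Quotient of a ring whose axioms hold up to an equivalence [sequ]; used for
   stalks and localizations. *)
Definition quot (S : setoid_ring) : Type :=
  {C : set S | exists x, C = sequ x}.

Section Quot.
Variable S : setoid_ring.
Implicit Types (x y z : S) (q r : quot S).

Lemma quot_inj q r : proj1_sig q = proj1_sig r -> q = r.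
Proof.
case: q r => [C hC] [D hD] /= e; rewrite e in hC *.
by congr exist; exact: Prop_irrelevance.
Qed.

Definition class_of x : quot S :=
  exist _ (@sequ S x) (ex_intro _ x (erefl (@sequ S x))).
Definition rep q : S := projT1 (cid (proj2_sig q)).

Lemma class_ofP x y : class_of x = class_of y <-> sequ x y.
Proof.
split=> [/(congr1 (fun q : quot S => proj1_sig q y))/= ->|xy].
  exact: sequ_refl.
apply: quot_inj => /=; apply/funext => z; apply/propext.
by split; apply: sequ_trans => //; apply: sequ_sym.
Qed.

Lemma repK q : class_of (rep q) = q.
Proof. by apply: quot_inj => /=; rewrite /rep; case: cid => x /= ->. Qed.

Lemma rep_class x : sequ (rep (class_of x)) x.
Proof. by apply/class_ofP; rewrite repK. Qed.

Lemma quotP (K : quot S -> Prop) : (forall x, K (class_of x)) -> forall q, K q.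
Proof. by move=> h q; rewrite -(repK q). Qed.

Definition qopp q := class_of (sopp (rep q)).
Definition qadd q r := class_of (sadd (rep q) (rep r)).
Definition qmul q r := class_of (smul (rep q) (rep r)).

Lemma class_opp x : qopp (class_of x) = class_of (sopp x).
Proof. by apply/class_ofP/sopp_equ/rep_class. Qed.
Lemma class_add x y : qadd (class_of x) (class_of y) = class_of (sadd x y).
Proof. by apply/class_ofP/sadd_equ; apply: rep_class. Qed.
Lemma class_mul x y : qmul (class_of x) (class_of y) = class_of (smul x y).
Proof. by apply/class_ofP/smul_equ; apply: rep_class. Qed.

HB.instance Definition _ := gen_eqMixin (quot S).
HB.instance Definition _ := gen_choiceMixin (quot S).

Let qaddA : associative qadd.
Proof.
elim/quotP=> x; elim/quotP=> y; elim/quotP=> z; rewrite !class_add.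
exact/class_ofP/saddA.
Qed.
Let qaddC : commutative qadd.
Proof.
by elim/quotP=> x; elim/quotP=> y; rewrite !class_add; apply/class_ofP/saddC.
Qed.
Let qadd0 : left_id (class_of (s0 S)) qadd.
Proof. by elim/quotP=> x; rewrite !class_add; apply/class_ofP/sadd0. Qed.
Let qaddN : left_inverse (class_of (s0 S)) qopp qadd.
Proof.
by elim/quotP=> x; rewrite class_opp !class_add; apply/class_ofP/saddN.
Qed.
HB.instance Definition _ :=
  GRing.isZmodule.Build (quot S) qaddA qaddC qadd0 qaddN.

Let qmulA : associative qmul.
Proof.
elim/quotP=> x; elim/quotP=> y; elim/quotP=> z; rewrite !class_mul.
exact/class_ofP/smulA.
Qed.
Let qmulC : commutative qmul.
Proof.
by elim/quotP=> x; elim/quotP=> y; rewrite !class_mul; apply/class_ofP/smulC.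
Qed.
Let qmul1 : left_id (class_of (s1 S)) qmul.
Proof. by elim/quotP=> x; rewrite !class_mul; apply/class_ofP/smul1. Qed.
Let qmulD : left_distributive qmul (+%R : quot S -> quot S -> quot S).
Proof.
elim/quotP=> x; elim/quotP=> y; elim/quotP=> z.
have -> : class_of x + class_of y = class_of (sadd x y) by exact: class_add.
rewrite !class_mul.
have -> a b : class_of a + class_of b = class_of (sadd a b).
  exact: class_add.
exact/class_ofP/smulD.
Qed.
HB.instance Definition _ :=
  GRing.Zmodule_isComPzRing.Build (quot S) qmulA qmulC qmul1 qmulD.

Lemma class0 : 0 = class_of (s0 S). Proof. by []. Qed.
Lemma class1 : 1 = class_of (s1 S). Proof. by []. Qed.
Lemma classD x y : class_of x + class_of y = class_of (sadd x y).
Proof. exact: class_add. Qed.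
Lemma classN x : - class_of x = class_of (sopp x).
Proof. exact: class_opp. Qed.
Lemma classM x y : class_of x * class_of y = class_of (smul x y).
Proof. exact: class_mul. Qed.

End Quot.

Definition quot_map (S T : setoid_ring) (f : S -> T) (q : quot S) : quot T :=
  class_of (f (rep q)).

Lemma quot_mapE (S T : setoid_ring) (f : S -> T) :
  (forall x y, sequ x y -> sequ (f x) (f y)) ->
  forall x, quot_map f (class_of x) = class_of (f x).
Proof. by move=> fE x; apply/class_ofP/fE/rep_class. Qed.

Record spec (A : comPzRingType) : Type := SpecPoint {
  sprime :> set A;
  sprimeP : prime_ideal sprime
}.

Section Localization.
Variables (A : comPzRingType) (P : spec A).

Record fraction : Type := Fraction {
  num : A;
  den : A;
  denP : ~ P den
}.
Implicit Types x y z : fraction.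

Definition frac_equ x y : Prop :=
  exists t, ~ P t /\ t * (num x * den y - num y * den x) = 0.

Lemma prime1 : ~ P 1. Proof. by case: (sprimeP P). Qed.
Lemma primeM a b : ~ P a -> ~ P b -> ~ P (a * b).
Proof. by case: (sprimeP P) => _ _ h na nb /h[]. Qed.

Definition frac0 := Fraction 0 prime1.
Definition frac1 := Fraction 1 prime1.
Definition frac_opp x := Fraction (- num x) (@denP x).
Definition frac_add x y :=
  Fraction (num x * den y + num y * den x) (primeM (@denP x) (@denP y)).
Definition frac_mul x y :=
  Fraction (num x * num y) (primeM (@denP x) (@denP y)).

Let equ_of_eq x y : num x * den y = num y * den x -> frac_equ x y.
Proof. by move=> e; exists 1; rewrite e subrr mulr0; split=> //; exact: prime1. Qed.

Let equ_refl x : frac_equ x x. Proof. exact: equ_of_eq. Qed.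
Let equ_sym x y : frac_equ x y -> frac_equ y x.
Proof. by case=> t [nt e]; exists t; split=> //; rewrite -opprB mulrN e oppr0. Qed.
Let equ_trans x y z : frac_equ x y -> frac_equ y z -> frac_equ x z.
Proof.
case=> t [nt e] [u [nu e']]; exists (t * u * den y); split.
  by apply: primeM; [exact: primeM | exact: (@denP y)].
have -> : t * u * den y * (num x * den z - num z * den x) =
  u * den z * (t * (num x * den y - num y * den x)) +
  t * den x * (u * (num y * den z - num z * den y)) by ring.
by rewrite e e' !mulr0 addr0.
Qed.
Let opp_equ x x' : frac_equ x x' -> frac_equ (frac_opp x) (frac_opp x').
Proof.
case=> t [nt e]; exists t; split=> //=.
have -> : t * (- num x * den x' - - num x' * den x) =
  - (t * (num x * den x' - num x' * den x)) by ring.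
by rewrite e oppr0.
Qed.
Let add_equ x x' y y' : frac_equ x x' -> frac_equ y y' ->
  frac_equ (frac_add x y) (frac_add x' y').
Proof.
case=> t [nt e] [u [nu e']]; exists (t * u); split; first exact: primeM.
rewrite /=.
have -> : t * u * ((num x * den y + num y * den x) * (den x' * den y') -
    (num x' * den y' + num y' * den x') * (den x * den y)) =
  u * den y * den y' * (t * (num x * den x' - num x' * den x)) +
  t * den x * den x' * (u * (num y * den y' - num y' * den y)) by ring.
by rewrite e e' !mulr0 addr0.
Qed.
Let mul_equ x x' y y' : frac_equ x x' -> frac_equ y y' ->
  frac_equ (frac_mul x y) (frac_mul x' y').
Proof.
case=> t [nt e] [u [nu e']]; exists (t * u); split; first exact: primeM.
rewrite /=.
have -> : t * u * (num x * num y * (den x' * den y') -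
    num x' * num y' * (den x * den y)) =
  u * num y * den y' * (t * (num x * den x' - num x' * den x)) +
  t * num x' * den x * (u * (num y * den y' - num y' * den y)) by ring.
by rewrite e e' !mulr0 addr0.
Qed.

Definition frac_ring : setoid_ring.
Proof.
by refine (@SetoidRing fraction frac_equ frac0 frac1 frac_opp frac_add frac_mul
  equ_refl equ_sym equ_trans opp_equ add_equ mul_equ _ _ _ _ _ _ _ _);
  move=> *; apply: equ_of_eq => /=; ring.
Defined.

Definition localization : comPzRingType := quot frac_ring.

Definition frac (a b : A) (nb : ~ P b) : localization :=
  @class_of frac_ring (Fraction a nb).

Lemma fracP (a b c d : A) (nb : ~ P b) (nd : ~ P d) :
  frac a nb = frac c nd <-> exists t, ~ P t /\ t * (a * d - c * b) = 0.
Proof. exact: class_ofP. Qed.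

Lemma frac_ex (q : localization) : exists a b (nb : ~ P b), q = frac a nb.
Proof. by elim/quotP: q => -[a b nb]; exists a, b, nb. Qed.

Lemma frac_eq (a b c d : A) (nb : ~ P b) (nd : ~ P d) :
  a * d = c * b -> frac a nb = frac c nd.
Proof. by move=> e; apply/fracP; exists 1; split; [exact: prime1|rewrite e subrr mulr0]. Qed.

Lemma fracD (a b c d : A) (nb : ~ P b) (nd : ~ P d) (n : ~ P (b * d)) :
  frac a nb + frac c nd = frac (a * d + c * b) n.
Proof. by rewrite /frac classD; apply/class_ofP; apply: equ_of_eq. Qed.
Lemma fracM (a b c d : A) (nb : ~ P b) (nd : ~ P d) (n : ~ P (b * d)) :
  frac a nb * frac c nd = frac (a * c) n.
Proof. by rewrite /frac classM; apply/class_ofP; apply: equ_of_eq. Qed.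
Lemma fracN (a b : A) (nb : ~ P b) : - frac a nb = frac (- a) nb.
Proof. by rewrite /frac classN; apply/class_ofP; apply: equ_of_eq. Qed.
Lemma frac_0 : 0 = frac 0 prime1. Proof. by []. Qed.
Lemma frac_1 : 1 = frac 1 prime1. Proof. by []. Qed.

End Localization.
Arguments prime1 {A} P.

Record opens (X : topologicalType) : Type := Opens {
  oset :> set X;
  osetP : open oset
}.

Definition opensT (X : topologicalType) : opens X := Opens openT.
Definition opensI (X : topologicalType) (U V : opens X) : opens X :=
  Opens (openI (osetP U) (osetP V)).
Definition preim_open (X Y : topologicalType) (f : X -> Y) (fc : continuous f)
    (V : opens Y) : opens X :=
  Opens (open_comp (fun x _ => fc x) (osetP V)).

Record ringed_space : Type := RingedSpace {
  space :> topologicalType;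
  sec : opens space -> comPzRingType;
  res : forall U V : opens space, V `<=` U -> {rmorphism sec U -> sec V};
  res_id : forall (U : opens space) (h : U `<=` U) (s : sec U), res h s = s;
  res_comp : forall (U V W : opens space)
    (h : V `<=` U) (h' : W `<=` V) (h'' : W `<=` U) (s : sec U),
    res h' (res h s) = res h'' s;
  sheaf_sep : forall (U : opens space) (I : Type) (V : I -> opens space)
    (hV : forall i, V i `<=` U), U `<=` \bigcup_i V i ->
    forall s t : sec U, (forall i, res (hV i) s = res (hV i) t) -> s = t;
  sheaf_glue : forall (U : opens space) (I : Type) (V : I -> opens space)
    (hV : forall i, V i `<=` U), U `<=` \bigcup_i V i ->
    forall s : forall i, sec (V i),
    (forall i j (hi : opensI (V i) (V j) `<=` V i)
       (hj : opensI (V i) (V j) `<=` V j), res hi (s i) = res hj (s j)) ->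
    exists t : sec U, forall i, res (hV i) t = s i
}.

Arguments sec {r} U.
Arguments res {r U V} h.

Section Stalk.
Variables (X : ringed_space) (x : X).

Record germ_at : Type := GermAt {
  gdom : opens X;
  gdomP : gdom x;
  gsec : sec gdom
}.
Implicit Types g h : germ_at.

Definition germ_equ g h : Prop :=
  exists (W : opens X) (wg : W `<=` gdom g) (wh : W `<=` gdom h),
    W x /\ res wg (gsec g) = res wh (gsec h).

Let interl g h : opensI (gdom g) (gdom h) `<=` gdom g.
Proof. exact: subIsetl. Qed.
Let interr g h : opensI (gdom g) (gdom h) `<=` gdom h.
Proof. exact: subIsetr. Qed.
Let interP g h : opensI (gdom g) (gdom h) x.
Proof. by split; apply: gdomP. Qed.

Definition germ0 := @GermAt (opensT X) Logic.I 0.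
Definition germ1 := @GermAt (opensT X) Logic.I 1.
Definition germ_opp g := GermAt (@gdomP g) (- gsec g).
Definition germ_add g h :=
  GermAt (@interP g h) (res (@interl g h) (gsec g) + res (@interr g h) (gsec h)).
Definition germ_mul g h :=
  GermAt (@interP g h) (res (@interl g h) (gsec g) * res (@interr g h) (gsec h)).

Let equ_of_eq g h (W : opens X) : W x ->
  forall (wg : W `<=` gdom g) (wh : W `<=` gdom h),
  res wg (gsec g) = res wh (gsec h) -> germ_equ g h.
Proof. by move=> Wx wg wh e; exists W, wg, wh. Qed.

Let equ_refl g : germ_equ g g.
Proof. by exists (gdom g), (@subset_refl _ _), (@subset_refl _ _); split=> //; apply: gdomP. Qed.
Let equ_sym g h : germ_equ g h -> germ_equ h g.
Proof. by case=> W [wg [wh [Wx e]]]; exists W, wh, wg. Qed.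
Let equ_trans g h k : germ_equ g h -> germ_equ h k -> germ_equ g k.
Proof.
case=> W [wg [wh [Wx e]]] [W' [wh' [wk [W'x e']]]].
have l : opensI W W' `<=` W by exact: subIsetl.
have r : opensI W W' `<=` W' by exact: subIsetr.
exists (opensI W W'), (subset_trans l wg), (subset_trans r wk); split=> //.
rewrite -(res_comp wg l) e (res_comp wh l (subset_trans l wh)).
by rewrite -(res_comp wk r) -e' (res_comp wh' r (subset_trans l wh)).
Qed.
Let opp_equ g g' : germ_equ g g' -> germ_equ (germ_opp g) (germ_opp g').
Proof.
by case=> W [wg [wh [Wx e]]]; exists W, wg, wh; split=> //=; rewrite !rmorphN e.
Qed.

Let bin_equ (op : forall U : opens X, sec U -> sec U -> sec U) :
  (forall (U V : opens X) (h : V `<=` U) s t, res h (op U s t) = op V (res h s) (res h t)) ->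
  forall g g' h h', germ_equ g g' -> germ_equ h h' ->
  germ_equ (GermAt (@interP g h) (op _ (res (@interl g h) (gsec g)) (res (@interr g h) (gsec h))))
    (GermAt (@interP g' h') (op _ (res (@interl g' h') (gsec g')) (res (@interr g' h') (gsec h')))).
Proof.
move=> opr g g' h h' [W [wg [wg' [Wx e]]]] [W' [wh [wh' [W'x e']]]].
have l : opensI W W' `<=` W by exact: subIsetl.
have r : opensI W W' `<=` W' by exact: subIsetr.
have d : opensI W W' `<=` opensI (gdom g) (gdom h).
  by move=> y [/wg ? /wh].
have d' : opensI W W' `<=` opensI (gdom g') (gdom h').
  by move=> y [/wg' ? /wh'].
exists (opensI W W'), d, d'; split=> //=; rewrite !opr; congr op.
  rewrite (res_comp _ _ (subset_trans l wg)) (res_comp _ _ (subset_trans l wg')).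
  by rewrite -(res_comp wg l) e (res_comp wg' l (subset_trans l wg')).
rewrite (res_comp _ _ (subset_trans r wh)) (res_comp _ _ (subset_trans r wh')).
by rewrite -(res_comp wh r) e' (res_comp wh' r (subset_trans r wh')).
Qed.
Let add_equ g g' h h' : germ_equ g g' -> germ_equ h h' ->
  germ_equ (germ_add g h) (germ_add g' h').
Proof. by apply: (@bin_equ (fun U => +%R)) => *; exact: rmorphD. Qed.
Let mul_equ g g' h h' : germ_equ g g' -> germ_equ h h' ->
  germ_equ (germ_mul g h) (germ_mul g' h').
Proof. by apply: (@bin_equ (fun U => *%R)) => *; exact: rmorphM. Qed.

Let resP (U V W : opens X) (a : V `<=` U) (b : W `<=` V) (c : W `<=` U) s :
  res b (res a s) = res c s.
Proof. exact: res_comp. Qed.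

Let equW (W : opens X) : W x -> forall g h, W `<=` gdom g -> W `<=` gdom h ->
  (forall (wg : W `<=` gdom g) (wh : W `<=` gdom h),
    res wg (gsec g) = res wh (gsec h)) -> germ_equ g h.
Proof. by move=> Wx g h wg wh e; apply: (equ_of_eq Wx (e wg wh)). Qed.

(* compare two germs on the common domain of [g], [h] and [k] *)
Local Ltac germ_ring g h k :=
  let W := constr:(opensI (gdom g) (opensI (gdom h) (gdom k))) in
  let wg := fresh in let wh := fresh in let wk := fresh in
  let wgh := fresh in let whk := fresh in let wgk := fresh in
  have wg : W `<=` gdom g by [move=> ? []];
  have wh : W `<=` gdom h by [move=> ? [_ []]];
  have wk : W `<=` gdom k by [move=> ? [_ []]];
  have wgh : W `<=` opensI (gdom g) (gdom h) by [move=> ? [? []]];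
  have wgk : W `<=` opensI (gdom g) (gdom k) by [move=> ? [? []]];
  have whk : W `<=` opensI (gdom h) (gdom k) by [move=> ? [? []]];
  apply: (@equW W);
  [ by do ?[split]; apply: gdomP
  | by move=> y [? [? ?]]; do ?[split]
  | by move=> y [? [? ?]]; do ?[split]
  | let wu := fresh in let wv := fresh in
    move=> wu wv; try rewrite (Prop_irrelevance wv wg);
    rewrite /= ?(rmorphD, rmorphM, rmorphN, rmorph0, rmorph1) /=
      ?(rmorphD, rmorphM, rmorphN, rmorph0, rmorph1) /=
      ?(resP _ _ wgh, resP _ _ whk, resP _ _ wgk) ?(resP _ _ wg, resP _ _ wh, resP _ _ wk);
      ring ].

Definition stalk_setoid : setoid_ring.
Proof.
refine (@SetoidRing germ_at germ_equ germ0 germ1 germ_opp germ_add germ_mul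
  equ_refl equ_sym equ_trans opp_equ add_equ mul_equ _ _ _ _ _ _ _ _).
- move=> g h k; germ_ring g h k.
- move=> g h; germ_ring g h h.
- move=> g; germ_ring g g g.
- move=> g; germ_ring g g g.
- move=> g h k; germ_ring g h k.
- move=> g h; germ_ring g h h.
- move=> g; germ_ring g g g.
- move=> g h k; germ_ring g h k.
Defined.
End Stalk.

Definition stalk (X : ringed_space) (x : X) : comPzRingType :=
  quot (stalk_setoid x).

Definition germ (X : ringed_space) (x : X) (U : opens X) (Ux : U x)
    (s : sec U) : stalk x :=
  @class_of (stalk_setoid x) (GermAt Ux s).

Section Germ.
Variables (X : ringed_space) (x : X).

Lemma germP (U V : opens X) (Ux : U x) (Vx : V x) (s : sec U) (t : sec V) :
  germ Ux s = germ Vx t <->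
  exists (W : opens X) (hU : W `<=` U) (hV : W `<=` V),
    W x /\ res hU s = res hV t.
Proof. exact: class_ofP. Qed.

Lemma germ_ex (g : stalk x) :
  exists (U : opens X) (Ux : U x) (s : sec U), g = germ Ux s.
Proof. by elim/quotP: g => -[U Ux s]; exists U, Ux, s. Qed.

Lemma germ_res (U V : opens X) (Ux : U x) (Vx : V x) (h : V `<=` U)
  (s : sec U) : germ Vx (res h s) = germ Ux s.
Proof.
apply/germP; exists V, (@subset_refl _ _), h; split=> //.
by rewrite res_id.
Qed.

Lemma germ_common (g h : stalk x) :
  exists (U : opens X) (Ux : U x) (s t : sec U), g = germ Ux s /\ h = germ Ux t.
Proof.
have [U [Ux [s ->]]] := germ_ex g; have [V [Vx [t ->]]] := germ_ex h.
have hU : opensI U V `<=` U by exact: subIsetl.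
have hV : opensI U V `<=` V by exact: subIsetr.
have W : opensI U V x by [].
by exists (opensI U V), W, (res hU s), (res hV t); rewrite !germ_res.
Qed.

Let irr (U V : opens X) (h : V `<=` U) (h' : V `<=` U) (s : sec U) :
  res h s = res h' s.
Proof. by rewrite (Prop_irrelevance h h'). Qed.

Lemma germD (U : opens X) (Ux : U x) (s t : sec U) :
  germ Ux (s + t) = germ Ux s + germ Ux t.
Proof.
rewrite /germ classD /=; apply/class_ofP.
have h : opensI U U `<=` U by exact: subIsetl.
exists (opensI U U), h, (@subset_refl _ _); do !split=> //.
by rewrite /= res_id rmorphD; congr (_ + _); apply: irr.
Qed.
Lemma germM (U : opens X) (Ux : U x) (s t : sec U) :
  germ Ux (s * t) = germ Ux s * germ Ux t.
Proof.
rewrite /germ classM /=; apply/class_ofP.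
have h : opensI U U `<=` U by exact: subIsetl.
exists (opensI U U), h, (@subset_refl _ _); do !split=> //.
by rewrite /= res_id rmorphM; congr (_ * _); apply: irr.
Qed.
Lemma germN (U : opens X) (Ux : U x) (s : sec U) : germ Ux (- s) = - germ Ux s.
Proof. by rewrite /germ classN. Qed.
Lemma germ_1 (U : opens X) (Ux : U x) : germ Ux 1 = 1.
Proof.
have h : U `<=` opensT X by [].
by rewrite -(rmorph1 (res h)) (@germ_res (opensT X) U Logic.I).
Qed.
Lemma germ_0 (U : opens X) (Ux : U x) : germ Ux 0 = 0.
Proof.
have h : U `<=` opensT X by [].
by rewrite -(rmorph0 (res h)) (@germ_res (opensT X) U Logic.I).
Qed.
End Germ.

(* Morphisms of ringed spaces: [pull] is [f^# : O_Y -> f_* O_X]. *)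
Record rs_mor (X Y : ringed_space) : Type := RsMor {
  base :> X -> Y;
  base_cont : continuous base;
  pull : forall V : opens Y, {rmorphism sec V -> sec (preim_open base_cont V)};
  pull_res : forall (V W : opens Y) (h : W `<=` V)
    (h' : preim_open base_cont W `<=` preim_open base_cont V) (s : sec V),
    res h' (pull V s) = pull W (res h s)
}.

Arguments base_cont {X Y} r : rename.
Notation "f ^-1o V" := (preim_open (base_cont f) V) (at level 24).
Arguments pull {X Y} r V : rename.

Section StalkMap.
Variables (X Y : ringed_space) (f : rs_mor X Y) (x : X).

Definition pull_germ (g : germ_at (f x)) : germ_at x :=
  @GermAt X x (f ^-1o gdom g) (@gdomP _ _ g) (pull f _ (gsec g)).

Definition stalk_map : stalk (f x) -> stalk x :=
  @quot_map (stalk_setoid (f x)) (stalk_setoid x) pull_germ.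

Lemma stalk_mapE (V : opens Y) (Vfx : V (f x)) (Vx : (f ^-1o V) x) (s : sec V) :
  stalk_map (germ Vfx s) = germ Vx (pull f V s).
Proof.
rewrite /stalk_map /germ quot_mapE /=; last first.
  move=> g h [W [wg [wh [Wx e]]]].
  have pg : f ^-1o W `<=` f ^-1o gdom g by move=> y /wg.
  have ph : f ^-1o W `<=` f ^-1o gdom h by move=> y /wh.
  exists (f ^-1o W), pg, ph; split=> //=.
  by rewrite (pull_res wg) (pull_res wh) e.
by rewrite /pull_germ /= (Prop_irrelevance Vfx Vx).
Qed.

Let stalk_map_zmod : zmod_morphism stalk_map.
Proof.
move=> g h; have [V [Vx [s [t [-> ->]]]]] := germ_common g h.
by rewrite -germN -germD !(stalk_mapE _ (Vx : (f ^-1o V) x)) rmorphB germD germN.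
Qed.
HB.instance Definition _ :=
  GRing.isZmodMorphism.Build (stalk (f x)) (stalk x) stalk_map stalk_map_zmod.
Let stalk_map_monoid : monoid_morphism stalk_map.
Proof.
split=> [|g h].
  rewrite -(@germ_1 _ (f x) (opensT Y) Logic.I).
  by rewrite (stalk_mapE _ (Logic.I : (f ^-1o opensT Y) x)) rmorph1 germ_1.
have [V [Vx [s [t [-> ->]]]]] := germ_common g h.
by rewrite -germM !(stalk_mapE _ (Vx : (f ^-1o V) x)) rmorphM germM.
Qed.
HB.instance Definition _ :=
  GRing.isMonoidMorphism.Build (stalk (f x)) (stalk x) stalk_map stalk_map_monoid.
End StalkMap.
Arguments stalk_map {X Y} f x _.

Record lrspace : Type := LRSpace {
  lr_rs :> ringed_space;
  stalk_local : forall x : lr_rs, local_ring (stalk x)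
}.

Record lr_mor (X Y : lrspace) : Type := LRMor {
  lr_rsmor :> rs_mor X Y;
  lr_local : forall x : X, local_hom (stalk_map lr_rsmor x)
}.

(* Equality of morphisms. The restriction only identifies
   [sec (g ^-1o V)] with [sec (f ^-1o V)], as [f = g] on points. *)
Definition eq_mor (X Y : lrspace) (f g : lr_mor X Y) : Prop :=
  (forall x, f x = g x) /\
  forall (V : opens Y) (h : f ^-1o V `<=` g ^-1o V) (s : sec V),
    res h (pull g V s) = pull f V s.

Section Identity.
Variable X : lrspace.

Let id_cont : continuous (@idfun X). Proof. by move=> x; exact: cvg_id. Qed.
Let id_le (V : opens X) : preim_open id_cont V `<=` V. Proof. by []. Qed.
Let id_res (V W : opens X) (h : W `<=` V) (h' : preim_open id_cont W `<=` preim_open id_cont V)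
  (s : sec V) : res h' (res (@id_le V) s) = res (@id_le W) (res h s).
Proof. have h2 : preim_open id_cont W `<=` V by [].
by rewrite (res_comp (@id_le V) h' h2) (res_comp h (@id_le W) h2). Qed.

Definition rs_id : rs_mor X X := RsMor id_res.

Let id_local (x : X) : local_hom (stalk_map rs_id x).
Proof.
move=> M N hM hN; have [M0 [_ u]] := stalk_local x.
rewrite -(u _ hM) (u _ hN); apply/seteqP; split=> g /=.
  have [V [Vx [s ->]]] := germ_ex g.
  by rewrite (stalk_mapE _ (Vx : (rs_id ^-1o V) x)) germ_res.
have [V [Vx [s ->]]] := germ_ex g.
by rewrite (stalk_mapE _ (Vx : (rs_id ^-1o V) x)) germ_res.
Qed.

Definition lr_id : lr_mor X X := LRMor id_local.
End Identity.

Section Composition.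
Variables (X Y Z : lrspace) (g : lr_mor Y Z) (f : lr_mor X Y).

Let comp_cont : continuous (fun x => g (f x)).
Proof. by move=> x; apply: continuous_comp; exact: base_cont. Qed.
Let comp_le (V : opens Z) : preim_open comp_cont V `<=` f ^-1o (g ^-1o V).
Proof. by []. Qed.
Let comp_pull (V : opens Z) : {rmorphism sec V -> sec (preim_open comp_cont V)} :=
  res (@comp_le V) \o (pull f (g ^-1o V) \o pull g V).
Let comp_res (V W : opens Z) (h : W `<=` V)
  (h' : preim_open comp_cont W `<=` preim_open comp_cont V) (s : sec V) :
  res h' (comp_pull V s) = comp_pull W (res h s).
Proof.
have hg : g ^-1o W `<=` g ^-1o V by move=> y /h.
have hf : f ^-1o (g ^-1o W) `<=` f ^-1o (g ^-1o V) by move=> y /h.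
rewrite /comp_pull /= -(pull_res h hg) -(pull_res hg hf).
have h2 : preim_open comp_cont W `<=` f ^-1o (g ^-1o V) by move=> y /h.
by rewrite (res_comp _ h' h2) (res_comp hf _ h2).
Qed.

Definition rs_comp : rs_mor X Z := RsMor comp_res.

Let comp_local (x : X) : local_hom (stalk_map rs_comp x).
Proof.
move=> MA MC hA hC; have [MB [hB _]] := stalk_local (f x).
rewrite -(lr_local hA hB) -(lr_local hB hC).
apply/funext => s; have [V [Vx [t ->]]] := germ_ex s.
rewrite /preimage /=; congr MC.
rewrite (stalk_mapE _ (Vx : (rs_comp ^-1o V) x)) /=.
rewrite (stalk_mapE _ (Vx : (g ^-1o V) (f x))).
by rewrite (stalk_mapE _ (Vx : (f ^-1o (g ^-1o V)) x)) germ_res.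
Qed.

Definition lr_comp : lr_mor X Z := LRMor comp_local.
End Composition.

HB.instance Definition _ (A : comPzRingType) := gen_eqMixin (spec A).
HB.instance Definition _ (A : comPzRingType) := gen_choiceMixin (spec A).

Lemma spec_eq (A : comPzRingType) (P Q : spec A) :
  (sprime P : set A) = sprime Q -> P = Q.
Proof.
case: P Q => [P hP] [Q hQ] /= e; rewrite e in hP *.
by rewrite (Prop_irrelevance hP hQ).
Qed.

(* the complements of the closed sets V(E) *)
Definition zariski_open (A : comPzRingType) (U : set (spec A)) : Prop :=
  exists E : set A, U = [set P | ~ (E `<=` P)].

Section Zariski.
Variable A : comPzRingType.

Let zar_T : zariski_open [set: spec A].
Proof.
exists [set 1]; apply/seteqP; split=> // P _ /= h.
by case: (sprimeP P) => _ n1 _; apply: n1; apply: h.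
Qed.
Let zar_I : setI_closed (@zariski_open A).
Proof.
move=> U V [E ->] [F ->].
exists [set x | exists a b, [/\ E a, F b & x = a * b]].
apply/seteqP; split=> P /=; have [[_ _ iM] _ pM] := sprimeP P.
  move=> [nE nF] h; apply: nE => a Ea; apply: contrapT => nPa.
  apply: nF => b Fb; have : sprime P (a * b) by apply: h; exists a, b.
  by case/pM.
move=> n; split=> h; apply: n => _ [a [b [Ea Fb ->]]].
  by rewrite mulrC; apply: iM; apply: h.
by apply: iM; apply: h.
Qed.
Let zar_bigU (I : Type) (f : I -> set (spec A)) :
  (forall i, zariski_open (f i)) -> zariski_open (\bigcup_i f i).
Proof.
move=> h; have {}h i : exists E, f i = [set P | ~ (E `<=` sprime P)] := h i.
exists [set a | exists i E, f i = [set P | ~ (E `<=` sprime P)] /\ E a].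
apply/seteqP; split=> P /=.
  move=> [i _]; have [E fE] := h i; rewrite {1}fE => /= n F.
  by apply: n => a Ea; apply: F; exists i, E.
move=> n; apply: contrapT => m; apply: n => a [i [E [fE Ea]]].
apply: contrapT => nPa; apply: m; exists i => //.
by rewrite fE /= => /(_ a Ea).
Qed.
HB.instance Definition _ :=
  isOpenTopological.Build (spec A) zar_T zar_I zar_bigU.

Lemma spec_openE (U : set (spec A)) : open U <-> zariski_open U.
Proof. by []. Qed.
End Zariski.

(* Sections over [U]: families of elements of the localizations A_P, P in U,
   that are locally of the form a/b with a, b in A. *)
Definition locally_fraction (A : comPzRingType) (U : set (spec A))
    (s : forall P, U P -> localization P) : Prop :=
  forall P, U P -> exists (V : opens (spec A)) (hV : V `<=` U) (a b : A),
    V P /\ forall Q (VQ : V Q), exists nb : ~ Q b, s Q (hV Q VQ) = frac a nb.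

Record spec_section (A : comPzRingType) (U : opens (spec A)) : Type :=
  SpecSection {
    spec_val :> forall P, U P -> localization P;
    spec_valP : locally_fraction spec_val
  }.

Section SpecSections.
Variables (A : comPzRingType) (U : opens (spec A)).
Implicit Types s t : spec_section U.

Lemma spec_section_eq s t : (forall P (UP : U P), s P UP = t P UP) -> s = t.
Proof.
case: s t => [s hs] [t ht] /= e.
have est : s = t.
  apply: functional_extensionality_dep => P.
  by apply: functional_extensionality_dep => UP; exact: e.
by rewrite est in hs *; rewrite (Prop_irrelevance hs ht).
Qed.

Definition const_sec (a b : A) (nb : forall P, U P -> ~ P b) : spec_section U.
Proof.
exists (fun P UP => frac a (nb P UP)) => P UP.
exists U, (@subset_refl _ _), a, b; split=> // Q UQ.
by exists (nb Q (@subset_refl _ U Q UQ)).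
Defined.

Let not1 P : U P -> ~ P 1. Proof. by move=> _; exact: prime1. Qed.

Definition sec0 : spec_section U := const_sec 0 not1.
Definition sec1 : spec_section U := const_sec 1 not1.

Definition sec_opp s : spec_section U.
Proof.
exists (fun P UP => - s P UP) => P UP.
have [V [hV [a [b [VP h]]]]] := spec_valP s UP.
exists V, hV, (- a), b; split=> // Q VQ; have [nb e] := h Q VQ.
by exists nb; rewrite e fracN.
Defined.

Let sec_bin (op : forall P : spec A, localization P -> localization P -> localization P)
    (n : A -> A -> A -> A -> A) :
  (forall (P : spec A) a b c d (nb : ~ P b) (nd : ~ P d) (nbd : ~ P (b * d)),
    op P (frac a nb) (frac c nd) = frac (n a b c d) nbd) ->
  forall s t, locally_fraction (fun P UP => op P (s P UP) (t P UP)).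
Proof.
move=> opE s t P UP.
have [V [hV [a [b [VP h]]]]] := spec_valP s UP.
have [W [hW [c [d [WP k]]]]] := spec_valP t UP.
have hVW : opensI V W `<=` U by move=> Q [/hV].
exists (opensI V W), hVW, (n a b c d), (b * d); split=> // Q [VQ WQ].
have [nb e] := h Q VQ; have [nd f] := k Q WQ.
exists (primeM nb nd).
rewrite -(opE _ _ _ _ _ nb nd) -e -f.
by congr op; congr (spec_val _ _); apply: Prop_irrelevance.
Qed.

Definition sec_add s t : spec_section U :=
  @SpecSection A U (fun P UP => s P UP + t P UP)
    (@sec_bin (fun _ => +%R) (fun a b c d => a * d + c * b)
      (fun P a b c d nb nd n => fracD a c nb nd n) s t).
Definition sec_mul s t : spec_section U :=
  @SpecSection A U (fun P UP => s P UP * t P UP)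
    (@sec_bin (fun _ => *%R) (fun a b c d => a * c)
      (fun P a b c d nb nd n => fracM a c nb nd n) s t).

HB.instance Definition _ := gen_eqMixin (spec_section U).
HB.instance Definition _ := gen_choiceMixin (spec_section U).

Let sec_addA : associative sec_add.
Proof. by move=> s t u; apply: spec_section_eq => P UP; exact: addrA. Qed.
Let sec_addC : commutative sec_add.
Proof. by move=> s t; apply: spec_section_eq => P UP; exact: addrC. Qed.
Let frac01 (P : spec A) (n : ~ P 1) (a : A) : frac a n = frac a (prime1 P).
Proof. exact: frac_eq. Qed.
Let sec_add0 : left_id sec0 sec_add.
Proof.
move=> s; apply: spec_section_eq => P UP.
by rewrite [LHS]/= frac01 -frac_0 add0r.
Qed.
Let sec_addN : left_inverse sec0 sec_opp sec_add.
Proof.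
move=> s; apply: spec_section_eq => P UP.
by rewrite [RHS]/= frac01 -frac_0 [LHS]/= addNr.
Qed.
HB.instance Definition _ := GRing.isZmodule.Build (spec_section U)
  sec_addA sec_addC sec_add0 sec_addN.
Let sec_mulA : associative sec_mul.
Proof. by move=> s t u; apply: spec_section_eq => P UP; exact: mulrA. Qed.
Let sec_mulC : commutative sec_mul.
Proof. by move=> s t; apply: spec_section_eq => P UP; exact: mulrC. Qed.
Let sec_mul1 : left_id sec1 sec_mul.
Proof.
move=> s; apply: spec_section_eq => P UP.
by rewrite [LHS]/= frac01 -frac_1 mul1r.
Qed.
Let sec_mulD : left_distributive sec_mul sec_add.
Proof. by move=> s t u; apply: spec_section_eq => P UP; exact: mulrDl. Qed.
HB.instance Definition _ := GRing.Zmodule_isComPzRing.Build (spec_section U)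
  sec_mulA sec_mulC sec_mul1 sec_mulD.

Lemma spec_val1 P (UP : U P) : (1 : spec_section U) P UP = 1.
Proof. exact: frac01. Qed.
Lemma spec_valD s t P (UP : U P) : (s + t) P UP = s P UP + t P UP.
Proof. by []. Qed.
Lemma spec_valN s P (UP : U P) : (- s) P UP = - s P UP.
Proof. by []. Qed.
Lemma spec_valM s t P (UP : U P) : (s * t) P UP = s P UP * t P UP.
Proof. by []. Qed.
End SpecSections.

Section SpecRes.
Variables (A : comPzRingType) (U V : opens (spec A)) (h : V `<=` U).

Let res_sub (s : spec_section U) :
  locally_fraction (fun P (VP : V P) => s P (h VP)).
Proof.
move=> P VP; have [W [hW [a [b [WP k]]]]] := spec_valP s (h VP).
have hVW : opensI V W `<=` V by move=> Q [].
exists (opensI V W), hVW, a, b; split=> // Q [VQ WQ].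
have [nb e] := k Q WQ; exists nb; rewrite -e.
by congr (spec_val _ _); apply: Prop_irrelevance.
Qed.
Definition spec_res (s : spec_section U) : spec_section V :=
  SpecSection (res_sub s).

Let spec_res_zmod : zmod_morphism spec_res.
Proof. by move=> s t; apply: spec_section_eq. Qed.
HB.instance Definition _ := GRing.isZmodMorphism.Build
  (spec_section U) (spec_section V) spec_res spec_res_zmod.
Let spec_res_monoid : monoid_morphism spec_res.
Proof.
by split=> [|s t]; apply: spec_section_eq => // P VP; rewrite spec_val1 [LHS]spec_val1.
Qed.
HB.instance Definition _ := GRing.isMonoidMorphism.Build
  (spec_section U) (spec_section V) spec_res spec_res_monoid.
End SpecRes.

Section SpecRingedSpace.
Variable A : comPzRingType.

Let sres (U V : opens (spec A)) (h : V `<=` U) :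
  {rmorphism spec_section U -> spec_section V} := spec_res h.
Let sirr (U : opens (spec A)) (s : spec_section U) P (h h' : U P) : s P h = s P h'.
Proof. by rewrite (Prop_irrelevance h h'). Qed.
Let sres_id (U : opens (spec A)) (h : U `<=` U) (s : spec_section U) :
  sres h s = s.
Proof. by apply: spec_section_eq => P UP; exact: (sirr s). Qed.
Let sres_comp (U V W : opens (spec A)) (h : V `<=` U) (h' : W `<=` V)
  (h'' : W `<=` U) (s : spec_section U) : sres h' (sres h s) = sres h'' s.
Proof. by apply: spec_section_eq => P UP; exact: (sirr s). Qed.
Let sres_sep (U : opens (spec A)) (I : Type) (V : I -> opens (spec A))
  (hV : forall i, V i `<=` U) : U `<=` \bigcup_i V i ->
  forall s t : spec_section U, (forall i, sres (hV i) s = sres (hV i) t) -> s = t.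
Proof.
move=> cov s t e; apply: spec_section_eq => P UP.
have [i _ ViP] := cov P UP.
have := congr1 (fun u : spec_section (V i) => u P ViP) (e i).
by rewrite /= (sirr s _ UP) (sirr t _ UP).
Qed.
Let sres_glue (U : opens (spec A)) (I : Type) (V : I -> opens (spec A))
  (hV : forall i, V i `<=` U) : U `<=` \bigcup_i V i ->
  forall s : forall i, spec_section (V i),
  (forall i j (hi : opensI (V i) (V j) `<=` V i)
     (hj : opensI (V i) (V j) `<=` V j), sres hi (s i) = sres hj (s j)) ->
  exists t : spec_section U, forall i, sres (hV i) t = s i.
Proof.
move=> cov s e.
have {}cov P : U P -> exists i, V i P by move=> /cov[i _]; exists i.
have agree i j P (hi : V i P) (hj : V j P) : s i P hi = s j P hj.
  have := congr1 (fun u : spec_section (opensI (V i) (V j)) => u P (conj hi hj))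
    (e i j (@subIsetl _ _ _) (@subIsetr _ _ _)).
  by rewrite /= (sirr (s i) _ hi) (sirr (s j) _ hj).
pose t P (UP : U P) := s _ P (projT2 (cid (cov P UP))).
have tE i P (UP : U P) (hi : V i P) : t P UP = s i P hi by exact: agree.
have tl : locally_fraction t.
  move=> P UP; have [i ViP] := cov P UP.
  have [W [hW [a [b [WP k]]]]] := spec_valP (s i) ViP.
  exists W, (subset_trans hW (hV i)), a, b; split=> // Q WQ.
  have [nb eQ] := k Q WQ; exists nb; rewrite -eQ; exact: tE.
exists (SpecSection tl) => i; apply: spec_section_eq => P ViP; exact: tE.
Qed.

Definition spec_rs : ringed_space :=
  @RingedSpace (spec A) (fun U => spec_section U : comPzRingType)
    sres sres_id sres_comp sres_sep sres_glue.
End SpecRingedSpace.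

Lemma unit_local_ring (A : comPzRingType) (M : set A) :
  ideal M -> ~ M 1 -> (forall x, ~ M x -> exists y, x * y = 1) ->
  maximal_ideal M /\ forall N, maximal_ideal N -> M = N.
Proof.
move=> iM M1 Mu.
have Mbig N : ideal N -> ~ N 1 -> N `<=` M.
  move=> [_ _ NM] N1 x Nx; apply: contrapT => /Mu[y xy].
  by apply: N1; rewrite -xy mulrC; exact: NM.
split=> [|N [iN N1 Nmax]]; last exact: Nmax iM M1 (Mbig _ iN N1).
split=> // N iN N1 MN; apply/seteqP; split=> //; exact: Mbig.
Qed.

Section SpecLocal.
Variables (A : comPzRingType) (P : spec A).
Let X := spec_rs A.

Let idealP : ideal P. Proof. by case: (sprimeP P). Qed.
Let mulP x y : P (x * y) -> P x \/ P y. Proof. by case: (sprimeP P) => _ _; apply. Qed.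

Definition spec_eval (g : stalk (P : X)) : localization P :=
  gsec (rep g) P (@gdomP _ _ (rep g)).

Lemma spec_evalE (U : opens X) (UP : U P) (s : sec U) :
  spec_eval (germ UP s) = (s : spec_section U) P UP.
Proof.
have /class_ofP[W [wg [wh [WP e]]]] := repK (germ UP s).
have := congr1 (fun u : spec_section W => u P WP) e => /= {}e.
rewrite /spec_eval (Prop_irrelevance (@gdomP _ _ _) (wg P WP)) e.
by rewrite (Prop_irrelevance (wh P WP) UP).
Qed.

Lemma spec_eval1 : spec_eval 1 = 1.
Proof. by rewrite -(@germ_1 X P (opensT X) Logic.I) spec_evalE; exact: spec_val1. Qed.
Lemma spec_evalD g h : spec_eval (g + h) = spec_eval g + spec_eval h.
Proof.
have [U [UP [s [t [-> ->]]]]] := germ_common g h.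
by rewrite -germD !spec_evalE.
Qed.
Lemma spec_evalM g h : spec_eval (g * h) = spec_eval g * spec_eval h.
Proof.
have [U [UP [s [t [-> ->]]]]] := germ_common g h.
by rewrite -germM !spec_evalE.
Qed.
Lemma spec_eval0 : spec_eval 0 = 0.
Proof. by apply: (addrI (spec_eval 0)); rewrite -spec_evalD !addr0. Qed.

Definition loc_max : set (localization P) :=
  [set q | exists a b (nb : ~ P b), q = frac a nb /\ P a].

Lemma loc_maxE a b (nb : ~ P b) : loc_max (frac a nb) <-> P a.
Proof.
split=> [[c [d [nd [/fracP [t [nt e]] Pc]]]]|Pa]; last by exists a, b, nb.
have [P0 PD PM] := idealP.
have : P (t * (a * d - c * b)) by rewrite e.
case/mulP => // Pd.
have : P (a * d) by rewrite -(subrK (c * b) (a * d)); apply: PD => //; rewrite mulrC; apply: PM.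
by case/mulP.
Qed.

Definition stalk_max : set (stalk (P : X)) := [set g | loc_max (spec_eval g)].

Let stalk_max_ideal : ideal stalk_max.
Proof.
have [P0 PD PM] := idealP.
rewrite /stalk_max; split.
- by rewrite /= spec_eval0 frac_0; apply/loc_maxE.
- move=> g h /= [a [b [nb [eg Pa]]]] [c [d [nd [eh Pc]]]].
  rewrite spec_evalD eg eh (fracD a c nb nd (primeM nb nd)); apply/loc_maxE.
  by apply: PD; rewrite mulrC; apply: PM.
- move=> g h /= [c [d [nd [eh Pc]]]].
  have [a [b [nb eg]]] := frac_ex (spec_eval g).
  rewrite spec_evalM eg eh (fracM a c nb nd (primeM nb nd)); apply/loc_maxE.
  exact: PM.
Qed.
Let stalk_max1 : ~ stalk_max 1.
Proof. by rewrite /stalk_max /= spec_eval1 frac_1 => /loc_maxE; apply: prime1. Qed.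

Lemma basic_open_subproof (a : A) : open [set Q : spec A | ~ Q a].
Proof.
apply/spec_openE; exists [set a]; apply/seteqP; split=> Q /= h.
  by move=> k; apply: h; apply: k.
by move=> Qa; apply: h => _ ->.
Qed.
Definition basic_open (a : A) : opens (spec A) := Opens (basic_open_subproof a).

Let stalk_max_unit g : ~ stalk_max g -> exists h, g * h = 1.
Proof.
have [U [UP [s ->]]] := germ_ex g; rewrite /stalk_max /= spec_evalE => ns.
have [V [hV [a [b [VP k]]]]] := spec_valP s UP.
have nPa : ~ P a.
  move=> Pa; apply: ns; have [nb e] := k P VP; exists a, b, nb; split=> //.
  by rewrite -e; congr (spec_val _ _); apply: Prop_irrelevance.
pose W : opens X := opensI V (basic_open a).
have WP : W P by split.
have WU : W `<=` U by move=> Q [/hV].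
have nW Q : W Q -> ~ Q a by case.
exists (@germ X P W WP (const_sec b nW)).
rewrite -(@germ_res X P U W UP WP WU s) -germM -(germ_1 WP); congr germ.
apply: spec_section_eq => Q WQ; rewrite [LHS]spec_valM [RHS]spec_val1 /=.
have [VQ nQa] := WQ; have [nb e] := k Q VQ.
rewrite (Prop_irrelevance (WU Q WQ) (hV Q VQ)) e.
rewrite (fracM a b nb (nW Q WQ) (primeM nb (nW Q WQ))) frac_1.
by apply: frac_eq; rewrite mulr1 mul1r mulrC.
Qed.

Lemma stalk_max_maximal :
  maximal_ideal stalk_max /\ forall N, maximal_ideal N -> stalk_max = N.
Proof. exact: unit_local_ring stalk_max_ideal stalk_max1 stalk_max_unit. Qed.

Lemma spec_stalk_local : local_ring (stalk (P : X)).
Proof. by exists stalk_max; exact: stalk_max_maximal. Qed.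
End SpecLocal.

Definition Spec_lrs (A : comPzRingType) : lrspace :=
  @LRSpace (spec_rs A) (@spec_stalk_local A).

Section SpecMap.
Variables (A B : comPzRingType) (phi : {rmorphism A -> B}).

Let comap_prime (Q : spec B) : prime_ideal (fun a : A => Q (phi a)).
Proof.
have [[Q0 QD QM] Q1 Qp] := sprimeP Q; split.
- split=> [|x y|a x]; first by rewrite rmorph0.
    by rewrite rmorphD; apply: QD.
  by rewrite rmorphM; apply: QM.
- by rewrite rmorph1.
- by move=> x y; rewrite rmorphM; apply: Qp.
Qed.
Definition spec_comap (Q : spec B) : spec A := SpecPoint (comap_prime Q).

Let spec_comap_cont : continuous spec_comap.
Proof.
apply/continuousP => U /spec_openE[E ->]; apply/spec_openE.
exists [set phi a | a in E]; apply/seteqP; split=> Q /= n h; apply: n.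
  by move=> a Ea; apply: h; exists a.
by move=> _ [a Ea <-]; apply: h.
Qed.

Section LocMap.
Variable Q : spec B.
Let fmap (x : fraction (spec_comap Q)) : fraction Q :=
  @Fraction B Q (phi (num x)) (phi (den x)) (@denP _ _ x).
Definition loc_map (q : localization (spec_comap Q)) : localization Q :=
  @quot_map (frac_ring (spec_comap Q)) (frac_ring Q) fmap q.
Lemma loc_mapE a b (nb : ~ spec_comap Q b) :
  loc_map (frac a nb) = @frac B Q (phi a) (phi b) nb.
Proof.
rewrite /loc_map /frac quot_mapE // => x y [t [nt e]].
exists (phi t); split=> //=.
by rewrite -!rmorphM -rmorphB -rmorphM e rmorph0.
Qed.
Lemma loc_map1 : loc_map 1 = 1.
Proof. by rewrite frac_1 loc_mapE frac_1; apply: frac_eq; rewrite rmorph1. Qed.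
Lemma loc_mapD x y : loc_map (x + y) = loc_map x + loc_map y.
Proof.
have [a [b [nb ->]]] := frac_ex x; have [c [d [nd ->]]] := frac_ex y.
rewrite (fracD a c nb nd (primeM nb nd)) !loc_mapE.
rewrite (@fracD B Q _ _ _ _ nb nd (primeM (nb : ~ Q (phi b)) nd)).
by apply: frac_eq; rewrite !(rmorphD, rmorphM).
Qed.
Lemma loc_mapN x : loc_map (- x) = - loc_map x.
Proof. by have [a [b [nb ->]]] := frac_ex x; rewrite fracN !loc_mapE fracN rmorphN. Qed.
Lemma loc_mapM x y : loc_map (x * y) = loc_map x * loc_map y.
Proof.
have [a [b [nb ->]]] := frac_ex x; have [c [d [nd ->]]] := frac_ex y.
rewrite (fracM a c nb nd (primeM nb nd)) !loc_mapE.
rewrite (@fracM B Q _ _ _ _ nb nd (primeM (nb : ~ Q (phi b)) nd)).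
by apply: frac_eq; rewrite !rmorphM.
Qed.
End LocMap.

Section Pull.
Variable V : opens (spec A).
Let U := preim_open spec_comap_cont V.
Let pull_frac (s : spec_section V) :
  @locally_fraction B U (fun Q UQ => loc_map (s (spec_comap Q) UQ)).
Proof.
move=> Q UQ; have [W [hW [a [b [WQ k]]]]] := spec_valP s UQ.
have hU : preim_open spec_comap_cont W `<=` U by move=> R /hW.
exists (preim_open spec_comap_cont W), hU, (phi a), (phi b); split=> // R WR.
have [nb e] := k _ WR; exists nb.
by rewrite -loc_mapE -e; congr loc_map; congr (spec_val _ _); apply: Prop_irrelevance.
Qed.
Definition spec_pull (s : spec_section V) : spec_section U :=
  SpecSection (pull_frac s).
Let spec_pull_zmod : zmod_morphism spec_pull.
Proof.
move=> s t; apply: spec_section_eq => Q UQ.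
by rewrite [LHS]loc_mapD loc_mapN.
Qed.
HB.instance Definition _ := GRing.isZmodMorphism.Build
  (spec_section V) (spec_section U) spec_pull spec_pull_zmod.
Let spec_pull_monoid : monoid_morphism spec_pull.
Proof.
split=> [|s t]; apply: spec_section_eq => Q UQ; last by rewrite [LHS]loc_mapM.
rewrite [RHS]spec_val1 -(loc_map1 Q) -(@spec_val1 A V (spec_comap Q) UQ).
by [].
Qed.
HB.instance Definition _ := GRing.isMonoidMorphism.Build
  (spec_section V) (spec_section U) spec_pull spec_pull_monoid.
End Pull.

Let spec_pull_res (V W : opens (spec A)) (h : W `<=` V)
  (h' : preim_open spec_comap_cont W `<=` preim_open spec_comap_cont V)
  (s : spec_section V) : spec_res h' (spec_pull s) = spec_pull (spec_res h s).
Proof.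
apply: spec_section_eq => Q UQ; congr loc_map; congr (spec_val _ _).
exact: Prop_irrelevance.
Qed.

Definition spec_rs_map : rs_mor (spec_rs B) (spec_rs A) :=
  @RsMor (spec_rs B) (spec_rs A) spec_comap spec_comap_cont
    (fun V => spec_pull (V:=V)) spec_pull_res.

Let spec_map_local (Q : spec_rs B) : local_hom (stalk_map spec_rs_map Q).
Proof.
move=> MA MB hA hB.
have [_ uA] := stalk_max_maximal (spec_comap Q).
have [_ uB] := stalk_max_maximal Q.
rewrite -(uA _ hA) -(uB _ hB) /stalk_max; apply/funext => g.
have [V [VQ [s ->]]] := germ_ex g.
rewrite /preimage /= (stalk_mapE _ (VQ : (spec_rs_map ^-1o V) Q)) !spec_evalE /=.
have [a [b [nb ->]]] := frac_ex ((s : spec_section V) (spec_comap Q) VQ).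
by rewrite loc_mapE; apply/propext; rewrite !loc_maxE.
Qed.

Definition Spec_map_lrs : lr_mor (Spec_lrs B) (Spec_lrs A) :=
  @LRMor (Spec_lrs B) (Spec_lrs A) spec_rs_map spec_map_local.
End SpecMap.

Definition open_immersion (X Y : lrspace) (f : lr_mor X Y) : Prop :=
  [/\ injective f, forall U : set X, open U -> open (f @` U) &
      forall V : opens Y, V `<=` range f -> bijective (pull f V)].

(* An open subscheme isomorphic to Spec A is given as an open immersion [j]. *)
Record scheme : Type := Scheme {
  sch_lrs :> lrspace;
  sch_affine : forall x : sch_lrs,
    exists (A : comPzRingType) (j : lr_mor (Spec_lrs A) sch_lrs),
      open_immersion j /\ range j x
}.

Lemma lr_id_open_immersion (X : lrspace) : open_immersion (lr_id X).
Proof.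
split=> [x y //|U|V _]; first by rewrite image_id.
have h : V `<=` lr_id X ^-1o V by [].
have h' : lr_id X ^-1o V `<=` V by [].
exists (res h) => s /=.
  by rewrite (res_comp _ h (@subset_refl _ V)) res_id.
by rewrite (res_comp h _ (@subset_refl _ (lr_id X ^-1o V))) res_id.
Qed.

Lemma spec_affine (A : comPzRingType) (x : Spec_lrs A) :
  exists (B : comPzRingType) (j : lr_mor (Spec_lrs B) (Spec_lrs A)),
    open_immersion j /\ range j x.
Proof.
exists A, (lr_id (Spec_lrs A)); split; last by exists x.
exact: lr_id_open_immersion.
Qed.

Definition Spec (A : comPzRingType) : scheme := Scheme (@spec_affine A).

Definition Spec_map (A B : comPzRingType) (phi : {rmorphism A -> B}) :
  lr_mor (Spec B) (Spec A) := Spec_map_lrs phi.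

(* The last clause is surjectivity of the map of sheaves O_Y -> f_* O_X. *)
Definition closed_immersion (X Y : scheme) (f : lr_mor X Y) : Prop :=
  [/\ injective f, forall C : set X, closed C -> closed (f @` C) &
      forall (V : opens Y) (s : sec (f ^-1o V)) (y : Y), V y ->
        exists (W : opens Y) (h : f ^-1o W `<=` f ^-1o V) (t : sec W),
          [/\ W y, W `<=` V & pull f W t = res h s]].

Definition flat_mor (X Y : scheme) (f : lr_mor X Y) : Prop :=
  forall x : X, flat_hom (stalk_map f x).

(* [Z], with projections [p] and [q], is the fibre product [X ×_S Y] of
   [f] and [g] in the category of schemes. *)
Definition is_fiber_product (Z X Y S : scheme) (p : lr_mor Z X) (q : lr_mor Z Y)
    (f : lr_mor X S) (g : lr_mor Y S) : Prop :=
  eq_mor (lr_comp f p) (lr_comp g q) /\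
  forall (T : scheme) (a : lr_mor T X) (b : lr_mor T Y),
    eq_mor (lr_comp f a) (lr_comp g b) ->
    exists u : lr_mor T Z,
      [/\ eq_mor (lr_comp p u) a, eq_mor (lr_comp q u) b &
          forall u' : lr_mor T Z,
            eq_mor (lr_comp p u') a -> eq_mor (lr_comp q u') b -> eq_mor u' u].

Record sch_over (S : scheme) : Type := Over {
  over_sch :> scheme;
  structure : lr_mor over_sch S
}.
Arguments structure {S} s.

Definition over_mor (S : scheme) (X Y : sch_over S) (f : lr_mor X Y) : Prop :=
  eq_mor (lr_comp (structure Y) f) (structure X).

Definition irreducible_set (X : topologicalType) (Z : set X) : Prop :=
  Z !=set0 /\
  forall F G : set X, closed F -> closed G -> Z `<=` F `|` G ->
    Z `<=` F \/ Z `<=` G.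

Definition irreducible_chain (X : topologicalType) (d : nat) (Z : nat -> set X)
    : Prop :=
  (forall i, (i <= d)%N -> closed (Z i) /\ irreducible_set (Z i)) /\
  (forall i, (i < d)%N -> Z i `<` Z i.+1).

(* [d] is the supremum of the lengths of chains of irreducible closed subsets *)
Definition krull_dim (X : topologicalType) (d : nat) : Prop :=
  (exists Z : nat -> set X, irreducible_chain d Z) /\
  forall d', (exists Z : nat -> set X, irreducible_chain d' Z) -> (d' <= d)%N.

Definition liftable (R k : comPzRingType) (pi : {rmorphism R -> k})
    (X : sch_over (Spec k)) : Prop :=
  exists (Xt : sch_over (Spec R)) (i : lr_mor X Xt),
    [/\ flat_mor (structure Xt), closed_immersion i &
        is_fiber_product i (structure X) (structure Xt) (Spec_map pi)].

(* Main.v *)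
Require Import Defs.
From HB Require Import structures.
From mathcomp Require Import all_boot all_order all_algebra.
From mathcomp Require Import boolp classical_sets topology.
From mathcomp Require Import ring.

Set Implicit Arguments.
Unset Strict Implicit.
Unset Printing Implicit Defensive.

Import GRing.Theory.
Local Open Scope classical_set_scope.
Local Open Scope ring_scope.

(** Let P = p ^ e.  In every commutative ring

      (a + b) ^ P = a ^ P + b ^ P + p D(a, b),

    where D ([frob_defect]) is a polynomial with integer coefficients.  The
    algebra of X_n is a k-algebra with elements a, b and c = a + b, each of them
    a product of L = n + 1 elements whose P-th powers vanish, and with
    D(a, b) <> 0 ([defect_algebra]); here e = n + 1.

    Let X_n lift to Xt over R, and let M be the local ring of Xt at the image of
    the point of X_n: it is flat over the local ring S of Spec R at its closed
    point, with M / mM the stalk of X_n.  Choose an ideal I of S maximal among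
    those that do not contain p.  Then p r lies in I exactly when r lies in m,
    and I contains m ^ N for some N ([separating_primary_ideal]).  Lift the
    factors of a, b, c to M, with products a', b', c'.  The P-th power of each
    lifted factor lies in mM, so a' ^ P, b' ^ P, c' ^ P lie in (m ^ N) M, hence
    in IM, once L >= N.  Also q = a' + b' - c' lies in mM, so q ^ P lies in IM
    once P >= N.  Comparing the expansions of the two sides of a' + b' = q + c'
    modulo IM gives p D(a', b') = p D(q, c'), and the right hand side lies in
    p mM, hence in IM, because D(q, c') is a multiple of q.  By flatness,
    multiplication by p embeds M / mM into M / IM ([flat_colon]), so D(a', b')
    lies in mM, that is, D(a, b) = 0: a contradiction ([defect_obstruction]).
    The bound N depends on R only, while L and P grow with n.

    The many factors are what makes this work for ramified R: a single relation
    x ^ P = 0 only says that the P-th power of a lift lies in mM, and p may lie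
    in a high power of m.

    On the geometric side, the one fact needed about schemes is that the kernel
    of M -> O(X_n) is contained in mM ([lift_stalk_kernel]).  It follows from
    the universal property of the fibre product, applied to the spectrum of
    L / mL for a local ring L of an affine chart of Xt ([fiber_test]).

    Since every element of the algebra of X_n is the sum of a scalar and a
    nilpotent, the algebra maps onto k.  The transition morphisms are dual to
    A_(n+1) -> k -> A_n. *)

(** * Ideals and quotient rings *)

Section Ideals.
Variable A : comPzRingType.
Implicit Types (I J : set A) (x y : A).

Lemma ideal0 I : ideal I -> I 0.
Proof. by case. Qed.
Lemma idealD I x y : ideal I -> I x -> I y -> I (x + y).
Proof. by case=> _ + _; apply. Qed.
Lemma idealMl I x y : ideal I -> I y -> I (x * y).
Proof. by case=> _ _; apply. Qed.
Lemma idealMr I x y : ideal I -> I x -> I (x * y).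
Proof. by rewrite mulrC; apply: idealMl. Qed.
Lemma idealN I x : ideal I -> I x -> I (- x).
Proof. by rewrite -mulN1r; apply: idealMl. Qed.
Lemma idealB I x y : ideal I -> I x -> I y -> I (x - y).
Proof. by move=> iI Ix /(idealN iI); apply: idealD. Qed.
Lemma ideal_sum I (K : Type) (r : seq K) (P : pred K) (F : K -> A) :
  ideal I -> (forall i, P i -> I (F i)) -> I (\sum_(i <- r | P i) F i).
Proof.
move=> iI h; elim/big_rec: _ => [|i x Pi]; first exact: ideal0.
by apply: idealD => //; exact: h.
Qed.

Lemma ideal_inverse I x y u : ideal I -> u * y = 1 -> I (x * y) -> I x.
Proof.
move=> iI uy h; rewrite -(mulr1 x) -uy (mulrC u) mulrA; exact: idealMr.
Qed.

Lemma adjoin_ideal I x :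
  ideal I -> ideal [set y | exists s, I (y - s * x)].
Proof.
move=> iI; split=> /=.
- by exists 0; rewrite mul0r subr0; exact: ideal0.
- move=> y z [s Is] [t It]; exists (s + t).
  have -> : y + z - (s + t) * x = (y - s * x) + (z - t * x) by ring.
  exact: idealD.
- move=> a y [s Is]; exists (a * s).
  have -> : a * y - a * s * x = a * (y - s * x) by ring.
  exact: idealMl.
Qed.

Lemma colon_ideal I x : ideal I -> ideal [set y | I (y * x)].
Proof.
move=> iI; split=> /=; first by rewrite mul0r; exact: ideal0.
- by move=> y z; rewrite mulrDl; exact: idealD.
- by move=> a y; rewrite -mulrA; exact: idealMl.
Qed.

End Ideals.

Section QuotientRing.
Variables (A : comPzRingType) (I : set A) (iI : ideal I).

Let cong x y := I (x - y).
Let cong_eq x y : x = y -> cong x y.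
Proof. by move=> ->; rewrite /cong subrr; exact: ideal0. Qed.

Definition coset_setoid : setoid_ring.
Proof.
refine (@SetoidRing A cong 0 1 -%R +%R *%R
  _ _ _ _ _ _ _ _ _ _ _ _ _ _).
- by move=> x; exact: cong_eq.
- by move=> x y h; rewrite /cong -opprB; exact: idealN.
- move=> x y z h h'; rewrite /cong.
  have -> : x - z = (x - y) + (y - z) by ring.
  exact: idealD.
- move=> x y h; rewrite /cong.
  have -> : - x - - y = - (x - y) by ring.
  exact: idealN.
- move=> x x' y y' h h'; rewrite /cong.
  have -> : x + y - (x' + y') = (x - x') + (y - y') by ring.
  exact: idealD.
- move=> x x' y y' h h'; rewrite /cong.
  have -> : x * y - x' * y' = y * (x - x') + x' * (y - y') by ring.
  by apply: idealD => //; apply: idealMl.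
all: by move=> *; apply: cong_eq; ring.
Defined.

Definition quotient_ring : comPzRingType := quot coset_setoid.
Definition coset (x : A) : quotient_ring := @class_of coset_setoid x.

Let coset_zmod : zmod_morphism coset.
Proof. by move=> x y; rewrite /coset classN classD. Qed.
Let coset_monoid : monoid_morphism coset.
Proof. by split=> // x y; rewrite /coset classM. Qed.
HB.instance Definition _ :=
  GRing.isZmodMorphism.Build A quotient_ring coset coset_zmod.
HB.instance Definition _ :=
  GRing.isMonoidMorphism.Build A quotient_ring coset coset_monoid.

Lemma coset_rep (q : quotient_ring) : exists x, q = coset x.
Proof. by exists (rep q); rewrite /coset repK. Qed.

Lemma rep_coset x : I (rep (coset x) - x).
Proof. exact: (rep_class (S := coset_setoid)). Qed.

Lemma coset_eq0 x : coset x = 0 <-> I x.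
Proof. by rewrite -(rmorph0 coset) class_ofP /= /cong subr0. Qed.

Lemma coset_eq x y : coset x = coset y <-> I (x - y).
Proof. exact: class_ofP. Qed.

End QuotientRing.

(** * Algebras whose elements are scalars plus nilpotents *)

Definition scalar_plus_nil (k A : comPzRingType) (iota : k -> A) (x : A) : Prop :=
  exists c n, (x - iota c) ^+ n = 0.

(** When k is a field and A is not zero, these are the local algebras with nil
    maximal ideal and residue field k: the spectrum is one k-rational point. *)
Definition nil_augmented (k A : comPzRingType) (iota : k -> A) : Prop :=
  forall x, scalar_plus_nil iota x.

Lemma nilpotentD (A : comPzRingType) (x y : A) :
  (exists n, x ^+ n = 0) -> (exists n, y ^+ n = 0) -> exists n, (x + y) ^+ n = 0.
Proof.
move=> [m xm] [n yn]; exists (m + n)%N; rewrite exprDn big1 // => i _.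
case: (leqP i n) => [le_in|/ltnW lt_ni].
  by rewrite -addnBA // exprD xm !mul0r mul0rn.
by rewrite -(subnK lt_ni) [y ^+ _]exprD yn !mulr0 mul0rn.
Qed.

Lemma nilpotentMl (A : comPzRingType) (x y : A) :
  (exists n, y ^+ n = 0) -> exists n, (x * y) ^+ n = 0.
Proof. by move=> [n yn]; exists n; rewrite exprMn yn mulr0. Qed.

Section Augmentation.
Variables (k A : comPzRingType) (iota : {rmorphism k -> A}).

Lemma augmented_nil x : (exists n, x ^+ n = 0) -> scalar_plus_nil iota x.
Proof. by move=> [n xn]; exists 0, n; rewrite rmorph0 subr0. Qed.

Lemma augmentedD x y : scalar_plus_nil iota x -> scalar_plus_nil iota y ->
  scalar_plus_nil iota (x + y).
Proof.
move=> [c xc] [d yd]; exists (c + d).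
have -> : x + y - iota (c + d) = (x - iota c) + (y - iota d).
  by rewrite rmorphD; ring.
exact: nilpotentD.
Qed.

Lemma augmentedM x y : scalar_plus_nil iota x -> scalar_plus_nil iota y ->
  scalar_plus_nil iota (x * y).
Proof.
move=> [c xc] [d yd]; exists (c * d).
have -> : x * y - iota (c * d) = y * (x - iota c) + iota c * (y - iota d).
  by rewrite rmorphM; ring.
by apply: nilpotentD; apply: nilpotentMl.
Qed.

End Augmentation.

(** * An algebra with a nonzero Frobenius defect *)

(** The largest ideal inside the kernel of the additive map l.  Quotients by
    such ideals come with a built-in test for being nonzero: an element with
    l f <> 0 survives.  No ideal membership has to be decided. *)
Definition largest_ideal (T : comPzRingType) (V : zmodType) (l : T -> V) : set T :=
  [set f | forall g, l (f * g) = 0].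

Section LargestIdeal.
Variables (T : comPzRingType) (V : zmodType) (l : T -> V).
Hypothesis l_add : zmod_morphism l.

Let l0 : l 0 = 0.
Proof. by have := l_add 0 0; rewrite !subrr. Qed.
Let lD x y : l (x + y) = l x + l y.
Proof. by have := l_add x (- y); have := l_add 0 y; rewrite l0 !sub0r => ->; rewrite !opprK. Qed.

Lemma largest_idealP : ideal (largest_ideal l).
Proof.
split=> [g|f f' Jf Jf' g|a f Jf g].
- by rewrite mul0r.
- by rewrite mulrDl lD Jf Jf' addr0.
- by rewrite mulrAC mulrC; exact: Jf.
Qed.

Lemma largest_ideal_ker f : largest_ideal l f -> l f = 0.
Proof. by move=> /(_ 1); rewrite mulr1. Qed.

End LargestIdeal.

Lemma nontrivial_quotient (T : comPzRingType) (I : set T) :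
  ideal I -> ~ I 1 ->
  exists (C : comNzRingType) (q : {rmorphism T -> C}),
    (forall c, exists x, c = q x) /\ forall x, q x = 0 <-> I x.
Proof.
move=> iI nI1.
have nz : (1 : quotient_ring iI) != 0.
  by apply/eqP => e; apply/nI1/(coset_eq0 iI).
pose nzM := GRing.PzSemiRing_isNonZero.Build (quotient_ring iI) nz.
pose C : comNzRingType := HB.pack (quotient_ring iI) nzM.
exists C, (coset iI : {rmorphism T -> quotient_ring iI}); split.
  exact: coset_rep.
exact: coset_eq0.
Qed.

Section PolyQuotient.
Variables (B : comNzRingType) (C : comPzRingType).
Variable q : {rmorphism {poly {poly B}} -> C}.
Hypothesis q_surj : forall c, exists f, c = q f.

(** Such elements form a subring, and here it contains a set of generators: the
    image of B and the images of the two variables. *)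
Lemma poly_nil_augmented (k : comPzRingType) (iota : {rmorphism k -> B}) :
  nil_augmented iota -> (exists n, q 'X ^+ n = 0) ->
  (exists n, q ('X%:P) ^+ n = 0) ->
  nil_augmented (fun c => q (iota c)%:P%:P).
Proof.
move=> augB nilX nilY c; have {c}[f ->] := q_surj c.
pose j : {rmorphism k -> C} := q \o (polyC \o (polyC \o iota)).
change (scalar_plus_nil j (q f)).
elim/poly_ind: f => [|f g IH].
  by exists 0, 1%N; rewrite !rmorph0 subrr.
rewrite rmorphD rmorphM; apply: augmentedD.
  by apply: augmentedM => //; apply: augmented_nil.
elim/poly_ind: g => [|g b IHg].
  by exists 0, 1%N; rewrite !rmorph0 subrr.
rewrite !(rmorphD, rmorphM) /=; apply: augmentedD.
  by apply: augmentedM => //; apply: augmented_nil.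
have [c [n e]] := augB b; exists c, n.
rewrite -rmorphB -!polyCB -rmorphXn /=.
have -> : (b - iota c)%:P%:P ^+ n = ((b - iota c) ^+ n)%:P%:P :> {poly {poly B}}.
  by rewrite !rmorphXn.
by rewrite e !rmorph0.
Qed.
End PolyQuotient.

(** From i C(P, i) = P C(P - 1, i - 1): if p did not divide C(P, i), then P
    would divide i. *)
Lemma dvd_bin_prime_power (p n i : nat) :
  prime p -> (0 < i < p ^ n)%N -> (p %| 'C(p ^ n, i))%N.
Proof.
move=> pr_p /andP[i0 iP]; case: i i0 iP => // i _ iP.
rewrite -[(_ %| _)%N]negbK -prime_coprime //; apply/negP => cop.
have : (p ^ n %| i.+1 * 'C(p ^ n, i.+1))%N by rewrite -mul_bin_diag dvdn_mulr.
rewrite mulnC Gauss_dvdr ?coprimeXl //.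
by move=> /dvdn_leq -/(_ isT); rewrite leqNgt iP.
Qed.

(** For P a power of p, this is ((a + b) ^ P - a ^ P - b ^ P) / p, computed
    over the integers. *)
Definition frob_defect (A : pzSemiRingType) (p P : nat) (a b : A) : A :=
  \sum_(1 <= i < P) (a ^+ i * b ^+ (P - i)) *+ ('C(P, i) %/ p).

Lemma frob_defectE (A : comPzRingType) (p n : nat) (a b : A) : prime p ->
  (a + b) ^+ (p ^ n) =
  a ^+ (p ^ n) + b ^+ (p ^ n) + frob_defect p (p ^ n) a b *+ p.
Proof.
move=> pr_p; have := dvd_bin_prime_power (n := n) pr_p.
have : (0 < p ^ n)%N by rewrite expn_gt0 prime_gt0.
rewrite /frob_defect; case: (p ^ n)%N => // P _ dvd.
rewrite addrC exprDn -(big_mkord predT (fun i => b ^+ (P.+1 - i) * a ^+ i *+ 'C(P.+1, i))).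
rewrite big_nat_recr // big_ltn //= bin0 binn subn0 subnn !expr0 mulr1 mul1r !mulr1n.
rewrite [in RHS]addrAC [RHS]addrC addrA [RHS]addrC addrA; congr (_ + _).
rewrite [RHS]addrC; congr (_ + _).
rewrite -sumrMnl; apply: eq_big_nat => i iP.
by rewrite mulrC -mulrnA divnK // dvd.
Qed.

Lemma rmorph_frob_defect (A B : pzRingType) (f : {rmorphism A -> B}) p P a b :
  f (frob_defect p P a b) = frob_defect p P (f a) (f b).
Proof.
rewrite rmorph_sum; apply: eq_bigr => i _.
by rewrite rmorphMn rmorphM !rmorphXn.
Qed.

(** Pascal's rule and the vanishing of C(P, i + 1) modulo p. *)
Lemma pchar_binomial_pred (k : fieldType) (p n i : nat) : p \in [pchar k] ->
  (i < p ^ n)%N -> ('C((p ^ n).-1, i))%:R = (-1) ^+ i :> k.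
Proof.
move=> chp; have pr_p := pcharf_prime chp.
elim: i => [|i IH] lt_i; first by rewrite bin0.
have := dvd_bin_prime_power (n := n) (i := i.+1) pr_p lt_i.
rewrite (dvdn_pcharf chp) -[in 'C(_, _)](ltn_predK lt_i) binS natrD IH ?(ltnW lt_i) //.
by rewrite addr_eq0 exprS mulN1r => /eqP.
Qed.

(** With P = p ^ n.+1 and u = P / p, the coefficient of a ^ u b ^ (P - u) in the
    defect is C(P - 1, u - 1), which is 1 or -1 modulo p. *)
Lemma frob_defect_coef_neq0 (k : fieldType) (p n : nat) : p \in [pchar k] ->
  ('C(p ^ n.+1, p ^ n) %/ p)%:R != 0 :> k.
Proof.
move=> chp; have pr_p := pcharf_prime chp.
have u0 : (0 < p ^ n)%N by rewrite expn_gt0 prime_gt0.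
have p0 := prime_gt0 pr_p.
suff -> : ('C(p ^ n.+1, p ^ n) %/ p)%N = 'C((p ^ n.+1).-1, (p ^ n).-1).
  rewrite (pchar_binomial_pred chp) ?signr_eq0 //.
  by rewrite (leq_ltn_trans (leq_pred _)) // ltn_exp2l ?prime_gt1.
have := mul_bin_diag (p ^ n.+1) (p ^ n).-1.
rewrite prednK // expnSr -mulnA => /eqP; rewrite eqn_pmul2l // => /eqP <-.
by rewrite mulKn.
Qed.

(** The quotient of k[a, b] by the largest ideal on which the coefficient of
    a ^ u b ^ (P - u), u = P / p, vanishes.  Both exponents are less than P, so
    a ^ P and b ^ P are in that ideal; the defect is not, since its coefficient
    at this monomial is nonzero. *)
Lemma frobenius_pair (k : fieldType) (p n : nat) : p \in [pchar k] ->
  exists (B : comNzRingType) (iota : {rmorphism k -> B}) (a b : B),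
    [/\ nil_augmented iota, a ^+ (p ^ n.+1) = 0, b ^+ (p ^ n.+1) = 0 &
        frob_defect p (p ^ n.+1) a b != 0].
Proof.
move=> chp; have pr_p := pcharf_prime chp.
set P := (p ^ n.+1)%N; set u := (p ^ n)%N.
have u0 : (0 < u)%N by rewrite expn_gt0 prime_gt0.
have uP : (u < P)%N by rewrite ltn_exp2l ?prime_gt1.
pose T : comNzRingType := {poly {poly k}}.
pose l (f : T) := f`_u`_(P - u).
have l_add : zmod_morphism l by move=> f g; rewrite /l !coefB.
(* a is the outer variable of k[b][a], b is the inner one *)
pose a : T := 'X; pose b : T := ('X)%:P.
have lD : l (frob_defect p P a b) = ('C(P, u) %/ p)%:R.
  have mono i j m : l (a ^+ i * b ^+ j *+ m) = ((i == u) && (j == P - u)%N)%:R *+ m.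
    rewrite /l /a /b -rmorphXn !coefMn coefMC coefXn.
    rewrite mulr_natl coefMn coefXn (eq_sym i) (eq_sym j).
    by case: eqP; case: eqP.
  have -> : l (frob_defect p P a b) =
      \sum_(1 <= i < P) l (a ^+ i * b ^+ (P - i) *+ ('C(P, i) %/ p)).
    by rewrite /l !coef_sum.
  rewrite (bigD1_seq u) ?iota_uniq ?mem_index_iota ?u0 //= mono !eqxx.
  rewrite big1 ?addr0 // => i ne; rewrite mono (negPf ne) /=.
  exact: mul0rn.
have Jideal := largest_idealP l_add.
have nJD : ~ largest_ideal l (frob_defect p P a b).
  move=> /largest_ideal_ker; rewrite lD; apply/eqP.
  exact: frob_defect_coef_neq0.
have nJ1 : ~ largest_ideal l 1.
  by move=> J1; apply: nJD; rewrite -[X in largest_ideal l X]mulr1; exact: idealMl Jideal J1.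
have [B [q [q_surj q0]]] := nontrivial_quotient Jideal nJ1.
have aP : q a ^+ P = 0.
  rewrite -rmorphXn; apply/q0 => g.
  by rewrite /l /a coefXnM uP coef0.
have bP : q b ^+ P = 0.
  rewrite -rmorphXn; apply/q0 => g.
  by rewrite /l /b -rmorphXn coefCM coefXnM ltn_subrL u0 (leq_trans _ uP).
exists B, (q \o (polyC \o polyC)), (q a), (q b); split=> //.
  apply: (poly_nil_augmented q_surj (iota := idfun)).
  - by move=> c; exists c, 1%N; rewrite subrr.
  - by exists P.
  - by exists P.
by rewrite -rmorph_frob_defect; apply/eqP => /q0.
Qed.

(** Divide B[z, w] by the largest ideal in the kernel of the B-linear map l
    that sends z ^ i w ^ j to c ^ i if i = j and to 0 otherwise.  Then zw - c is
    in the ideal by construction, z ^ P and w ^ P are because c ^ P = 0, and B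
    embeds because l is the identity on B. *)
Lemma adjoin_factorization (k : comPzRingType) (B : comNzRingType)
    (iota : {rmorphism k -> B}) (c : B) (P : nat) :
  nil_augmented iota -> c ^+ P = 0 ->
  exists (B' : comNzRingType) (f : {rmorphism B -> B'}) (z w : B'),
    [/\ injective f, nil_augmented (f \o iota), f c = z * w &
        z ^+ P = 0 /\ w ^+ P = 0].
Proof.
move=> augB cP.
pose T : comNzRingType := {poly {poly B}}.
pose l (f : T) := \sum_(i < size f) f`_i`_i * c ^+ i.
have lE N (f : T) : (size f <= N)%N -> l f = \sum_(i < N) f`_i`_i * c ^+ i.
  move=> le_fN; rewrite /l (big_ord_widen _ (fun i => f`_i`_i * c ^+ i) le_fN).
  rewrite big_mkcond; apply: eq_bigr => i _; case: ltnP => // le_fi.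
  by rewrite [f`_i]nth_default // coef0 mul0r.
have l_add : zmod_morphism l.
  move=> f g; pose N := maxn (size f) (size g).
  rewrite (lE N (f - g)) ?(leq_trans (size_polyD _ _)) ?size_polyN //.
  rewrite (lE N f) ?leq_maxl // (lE N g) ?leq_maxr // -sumrB.
  by apply: eq_bigr => i _; rewrite !coefB mulrBl.
have lC b : l b%:P%:P = b.
  by rewrite (lE 1%N) ?size_polyC_leq1 // big_ord1 !coefC /= mulr1.
have Jideal := largest_idealP l_add.
have nJ1 : ~ largest_ideal l 1.
  move=> /largest_ideal_ker; rewrite -(rmorph1 polyC) -(rmorph1 polyC) lC.
  by apply/eqP/oner_neq0.
have [B' [q [q_surj q0]]] := nontrivial_quotient Jideal nJ1.
pose z := q 'X; pose w := q ('X)%:P.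
have zP : z ^+ P = 0.
  rewrite -rmorphXn; apply/q0 => g; rewrite /l big1 // => i _.
  rewrite coefXnM; case: ltnP => [_|leP]; first by rewrite coef0 mul0r.
  by rewrite -(subnK leP) exprD cP !mulr0.
have wP : w ^+ P = 0.
  have coefYn (g : T) m : (('X)%:P ^+ P * g)`_m = 'X^P * g`_m.
    by rewrite -rmorphXn coefCM.
  rewrite -rmorphXn; apply/q0 => g; rewrite /l big1 // => i _.
  rewrite coefYn coefXnM; case: ltnP => [_|leP]; first by rewrite mul0r.
  by rewrite -(subnK leP) exprD cP !mulr0.
exists B', (q \o (polyC \o polyC)), z, w; split=> //.
- move=> b b' /eqP; rewrite -subr_eq0 -rmorphB => /eqP/q0/largest_ideal_ker /=.
  by rewrite lC => /subr0_eq.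
- by apply: (poly_nil_augmented q_surj augB); exists P.
change (q c%:P%:P = z * w).
apply/eqP; rewrite -subr_eq0 -rmorphM -rmorphB; apply/eqP/q0 => g.
rewrite mulrBl l_add; apply/eqP; rewrite subr_eq0; apply/eqP.
have size_C (b : {poly B}) : (size (b%:P * g)%R <= size g)%N.
  by rewrite mul_polyC size_scale_leq.
have lc : l (c%:P%:P * g) = c * l g.
  rewrite (lE (size g)) ?size_C // /l mulr_sumr.
  by apply: eq_bigr => i _; rewrite !coefCM mulrA.
have assoc : 'X * ('X)%:P * g = 'X * (('X)%:P * g) by rewrite mulrA.
rewrite lc assoc [l ('X * _)](lE (size g).+1); last first.
  apply: leq_trans (size_polyMleq _ _) _.
  by rewrite size_polyX addSn add1n ltnS; exact: size_C.
rewrite big_ord_recl coefXM coef0 mul0r add0r mulr_sumr.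
apply: eq_bigr => i _; rewrite /= /bump /= add1n.
by rewrite coefXM /= coefCM coefXM /= exprS mulrCA.
Qed.

Definition long_nil_product (A : pzSemiRingType) (n P : nat) (a : A) : Prop :=
  exists s : seq A, [/\ size s = n, a = \prod_(x <- s) x &
                        forall x, x \in s -> x ^+ P = 0].

Lemma long_nil_product_morph (A B : pzSemiRingType) (f : {rmorphism A -> B})
    (n P : nat) (a : A) :
  long_nil_product n P a -> long_nil_product n P (f a).
Proof.
move=> [s [sz -> nil]]; exists [seq f x | x <- s]; split.
- by rewrite size_map.
- by rewrite rmorph_prod big_map.
- by move=> _ /mapP[x xs ->]; rewrite -rmorphXn nil // rmorph0.
Qed.

(** Factor c = z w, then w, and so on. *)
Lemma adjoin_long_product (k : comPzRingType) (B : comNzRingType)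
    (iota : {rmorphism k -> B}) (c : B) (P n : nat) :
  nil_augmented iota -> c ^+ P = 0 ->
  exists (B' : comNzRingType) (f : {rmorphism B -> B'}),
    [/\ injective f, nil_augmented (f \o iota) &
        long_nil_product n.+1 P (f c)].
Proof.
elim: n B iota c => [|n IH] B iota c augB cP.
  exists B, idfun; split=> //; exists [:: c]; split=> //.
    by rewrite big_seq1.
  by move=> x; rewrite inE => /eqP ->.
have [B1 [f [z [w [f_inj aug1 fc [zP wP]]]]]] := adjoin_factorization augB cP.
have [B2 [g [g_inj aug2 [s [sz gw nil]]]]] := IH B1 (f \o iota) w aug1 wP.
exists B2, (g \o f); split=> //; first exact: inj_comp.
exists (g z :: s); split=> [||x]; first by rewrite /= sz.
  by rewrite /= fc rmorphM big_cons -gw.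
rewrite inE => /orP[/eqP -> | /nil //].
by rewrite -rmorphXn zP rmorph0.
Qed.

(** The configuration that obstructs flat lifts: the product structure puts the
    P-th powers of lifts of a, b, c in (m ^ N) M, and flatness then forces the
    defect to vanish modulo m. *)
Definition defect_witness (A : pzSemiRingType) (p N P : nat) : Prop :=
  exists a b c : A,
    [/\ a + b = c, long_nil_product N P a, long_nil_product N P b,
        long_nil_product N P c & frob_defect p P a b <> 0].

(** All the adjunctions are injective, so the defect found in
    [frobenius_pair] stays nonzero.  There c ^ P = 0 holds as well, since p = 0
    leaves only a ^ P + b ^ P. *)
Lemma defect_algebra (k : fieldType) (p n : nat) : p \in [pchar k] ->
  exists (A : comNzRingType) (iota : {rmorphism k -> A}),
    nil_augmented iota /\ defect_witness A p n.+1 (p ^ n.+1).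
Proof.
move=> chp; have pr_p := pcharf_prime chp; set P := (p ^ n.+1)%N.
have [B [iota [a [b [aug aP bP /eqP D0]]]]] := frobenius_pair n chp.
have cP : (a + b) ^+ P = 0.
  rewrite frob_defectE // aP bP !add0r -mulr_natl.
  by rewrite -(rmorph_nat iota) pcharf0 // rmorph0 mul0r.
have [B1 [f1 [inj1 aug1 prod1]]] := adjoin_long_product n aug aP.
have b1P : (f1 b) ^+ P = 0 by rewrite -rmorphXn bP rmorph0.
have [B2 [f2 [inj2 aug2 prod2]]] := adjoin_long_product n aug1 b1P.
have c2P : (f2 (f1 (a + b))) ^+ P = 0 by rewrite -!rmorphXn cP !rmorph0.
have [B3 [f3 [inj3 aug3 prod3]]] := adjoin_long_product n aug2 c2P.
exists B3, (f3 \o (f2 \o (f1 \o iota))); split=> //.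
exists (f3 (f2 (f1 a))), (f3 (f2 (f1 b))), (f3 (f2 (f1 (a + b)))).
split=> //; first by rewrite !rmorphD.
- by do 2!apply: long_nil_product_morph.
- exact: long_nil_product_morph.
rewrite -!rmorph_frob_defect -(rmorph0 f3) => /inj3.
by rewrite -(rmorph0 f2) => /inj2; rewrite -(rmorph0 f1) => /inj1.
Qed.

(** * Noetherian local rings *)

Section Noetherian.
Variables (A : comPzRingType) (noethA : noetherian A).

(** Otherwise dependent choice gives a strictly increasing sequence; the finitely
    many generators of its union all lie in one member. *)
Lemma noetherian_maximal (F : set (set A)) :
  F `<=` @ideal A -> F !=set0 ->
  exists2 I, F I & forall J, F J -> I `<=` J -> J = I.
Proof.
move=> idF [I0 FI0]; apply: contrapT => nomax.
have next (I : {I | F I}) : exists J : {I | F I}, sval I `<=` sval J /\ sval J <> sval I.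
  case: I => I FI; apply: contrapT => stop; apply: nomax; exists I => // J FJ sIJ.
  by apply: contrapT => neq; apply: stop; exists (exist _ J FJ).
have [g gP] := choice next.
pose c i := iter i g (exist _ I0 FI0).
have idc i : ideal (sval (c i)) by case: (c i) => /= I /idF.
have mono i j : (i <= j)%N -> sval (c i) `<=` sval (c j).
  elim: j => [|j IH]; first by rewrite leqn0 => /eqP ->.
  rewrite leq_eqVlt => /orP[/eqP -> //|/IH h x /h]; exact: (proj1 (gP _)).
pose U : set A := [set x | exists i, sval (c i) x].
have idU : ideal U.
  split=> [|x y [i xi] [j yj]|a x [i xi]].
  - by exists 0%N; exact: ideal0.
  - exists (maxn i j); apply: idealD => //.
      by apply: mono xi; exact: leq_maxl.
    by apply: mono yj; exact: leq_maxr.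
  - by exists i; exact: idealMl.
have [n [s eU]] := noethA idU.
have Us i : U (s i).
  rewrite eU; exists (fun j => (j == i)%:R).
  rewrite (bigD1 i) //= eqxx mul1r big1 ?addr0 // => j /negPf ->.
  exact: mul0r.
have [h hP] := choice Us.
pose N := (\max_i h i)%N.
have UN : U `<=` sval (c N).
  rewrite eU => _ [a ->]; apply: ideal_sum => // i _; apply: idealMl => //.
  by apply: mono (hP i); exact: leq_bigmax.
have [sub neq] := gP (c N); apply: neq; apply/seteqP; split=> // x xN.
by apply: UN; exists N.+1.
Qed.

Lemma noetherian_surj (B : comPzRingType) (f : {rmorphism A -> B}) :
  (forall b, exists a, b = f a) -> noetherian B.
Proof.
move=> f_surj I iI.
have iJ : ideal (f @^-1` I).
  split=> /= [|x y|a x]; first by rewrite rmorph0; exact: ideal0.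
    by rewrite rmorphD; exact: idealD.
  by rewrite rmorphM; exact: idealMl.
have [n [g eJ]] := noethA iJ; exists n, (fun i => f (g i)).
apply/seteqP; split=> [b|_ [c ->]].
  have [a ->] := f_surj b => Ia.
  have : (f @^-1` I) a by [].
  rewrite eJ => -[c ->]; exists (fun i => f (c i)).
  by rewrite rmorph_sum; apply: eq_bigr => i _; rewrite rmorphM.
apply: ideal_sum => // i _; apply: idealMl => //.
have : (f @^-1` I) (g i); last by [].
rewrite eJ; exists (fun j => (j == i)%:R).
rewrite (bigD1 i) //= eqxx mul1r big1 ?addr0 // => j /negPf ->.
exact: mul0r.
Qed.

Variables (m : set A) (max_m : maximal_ideal m).
Hypothesis max_uniq : forall m', maximal_ideal m' -> m = m'.

Let im : ideal m. Proof. by case: max_m. Qed.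

Lemma local_noetherian_unit x : ~ m x -> exists y, y * x = 1.
Proof.
move=> nmx; apply: contrapT => nunit.
pose Ix : set A := [set y | exists s, y = s * x].
have iIx : ideal Ix.
  split=> [|_ _ [s ->] [t ->]|a _ [s ->]].
  - by exists 0; rewrite mul0r.
  - by exists (s + t); rewrite mulrDl.
  - by exists (a * s); rewrite mulrA.
pose F : set (set A) := [set J | [/\ ideal J, ~ J 1 & Ix `<=` J]].
have [||J [iJ nJ1 sJ] Jmax] := @noetherian_maximal F.
- by move=> J [].
- by exists Ix; split=> // -[s e]; apply: nunit; exists s.
apply: nmx; rewrite (max_uniq (m' := J)); first by apply: sJ; exists 1; rewrite mul1r.
split=> // K iK nK1 sJK; apply: Jmax => //; split=> //.
exact: subset_trans sJ sJK.
Qed.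

(** The colon ideal (I : m ^ n).  The condition that it contains 1 means that
    m ^ n is contained in I, and this recursive form avoids powers of ideals. *)
Fixpoint colon_power (I : set A) (n : nat) : set A :=
  if n is n'.+1 then [set s | forall r, m r -> colon_power I n' (s * r)] else I.

Lemma colon_power_ideal I n : ideal I -> ideal (colon_power I n).
Proof.
move=> iI; elim: n => //= n IH; split=> [r _|x y hx hy r mr|a x hx r mr].
- by rewrite mul0r; exact: ideal0.
- by rewrite mulrDl; apply: idealD => //; [exact: hx | exact: hy].
- by rewrite -mulrA; apply: idealMl => //; exact: hx.
Qed.

Lemma colon_powerS I n : ideal I -> colon_power I n `<=` colon_power I n.+1.
Proof.
move=> iI s Ks r _; apply: idealMr => //; exact: colon_power_ideal.
Qed.

Lemma colon_power_le I i j : ideal I -> (i <= j)%N ->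
  colon_power I i `<=` colon_power I j.
Proof.
move=> iI; elim: j => [|j IH]; first by rewrite leqn0 => /eqP ->.
by rewrite leq_eqVlt => /orP[/eqP -> //|/IH h x /h]; exact: colon_powerS.
Qed.

(** Let K be the largest of the ideals (I : m ^ n), so that (K : m) = K.  If 1 is
    not in K, take y outside K with (K : y) maximal.  Every r in m has a power in
    (K : y), and if e is the last exponent with y r ^ e outside K, then
    (K : y r ^ e) = (K : y) contains r.  So y m is contained in K, and y is in K
    after all. *)
Lemma primary_power I : ideal I ->
  (forall r, m r -> exists e, I (r ^+ e)) -> exists n, colon_power I n 1.
Proof.
move=> iI nilI.
pose F : set (set A) := [set K | exists n, K = colon_power I n].
have [||_ [n ->] nmax] := @noetherian_maximal F.
- by move=> _ [n ->]; exact: colon_power_ideal.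
- by exists I, 0%N.
pose K := colon_power I n; have iK : ideal K by exact: colon_power_ideal.
have stable s : (forall r, m r -> K (s * r)) -> K s.
  move=> h; rewrite /K -(nmax (colon_power I n.+1)) //; first by exists n.+1.
  exact: colon_powerS.
exists n; apply: contrapT => nK1.
pose G : set (set A) := [set L | exists2 y, ~ K y & L = [set s | K (s * y)]].
have [||_ [y nKy ->] ymax] := @noetherian_maximal G.
- by move=> _ [y _ ->]; exact: colon_ideal.
- by exists [set s | K (s * 1)], 1.
apply: nKy; apply: stable => r mr; apply: contrapT => nKyr.
have [e Ire] := nilI r mr.
have Kre : K (y * r ^+ e).
  by apply: idealMl => //; apply: (colon_power_le iI (leq0n n)).
elim: e {Ire} Kre => [|e IH] Kre.
  by apply: nKyr; apply: idealMr => //; move: Kre; rewrite expr0 mulr1.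
have [Kye|nKye] := pselect (K (y * r ^+ e)); first exact: IH.
have GG : G [set s | K (s * (y * r ^+ e))] by exists (y * r ^+ e).
have sub : [set s | K (s * y)] `<=` [set s | K (s * (y * r ^+ e))].
  by move=> s /= Ksy; rewrite mulrA; exact: idealMr.
(* e is the last exponent with y * r ^+ e outside K *)
have e1 := ymax _ GG sub; apply: nKyr; rewrite mulrC.
have : [set s | K (s * (y * r ^+ e))] r by rewrite /= mulrCA -exprS.
by rewrite e1.
Qed.

(** Take I maximal among the ideals that avoid t.  An element x outside I
    satisfies t = s x modulo I for some s.  For x = t r with r in m this would
    make the unit 1 - s r kill t modulo I.  For x = r ^ e with
    (I : r ^ e) = (I : r ^ (e + 1)) it gives s r ^ (e + 1) in I, because t r is in
    I, hence s r ^ e and t are in I.  So I contains t m and powers of all elements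
    of m. *)
Lemma separating_primary_ideal (t : A) : t <> 0 ->
  exists I : set A, [/\ ideal I, (forall r, I (t * r) <-> m r) &
    exists n, colon_power I n 1].
Proof.
move=> t0; have [_ nm1 _] := max_m.
have [||I [iI nIt] Imax] := @noetherian_maximal [set I | ideal I /\ ~ I t].
- by move=> I [].
- exists [set 0]; split=> //; split=> [//|x y -> ->|a x ->]; first exact: addr0.
  exact: mulr0.
have adj x : ~ I x -> exists s, I (t - s * x).
  move=> nIx; apply: contrapT => nadj; apply: nIx.
  have iJ := adjoin_ideal x iI.
  rewrite -(Imax [set y | exists s, I (y - s * x)]) //=.
    by exists 1; rewrite mul1r subrr; exact: ideal0.
  by move=> y Iy; exists 0; rewrite mul0r subr0.
have unit1 r : m r -> exists u, u * (1 - r) = 1.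
  move=> mr; apply: local_noetherian_unit => m1r; apply: nm1.
  by rewrite -(subrK r 1); exact: idealD.
have colt r : m r -> I (t * r).
  move=> mr; apply: contrapT => /adj[s Is]; apply: nIt.
  have [u eu] := unit1 (s * r) (idealMl _ im mr).
  apply: (ideal_inverse iI eu).
  by rewrite mulrBr mulr1 mulrCA.
exists I; split=> // [r|].
  split=> [Itr|]; last exact: colt.
  apply: contrapT => /local_noetherian_unit[u eu]; apply: nIt.
  exact: ideal_inverse iI eu Itr.
apply: primary_power => // r mr.
have [||_ [e ->] emax] := @noetherian_maximal
  [set K | exists e, K = [set s | I (s * r ^+ e)]].
- by move=> _ [e ->]; exact: colon_ideal.
- by exists [set s | I (s * r ^+ 0)], 0%N.
exists e; apply: contrapT => /adj[s Is].
apply: nIt; rewrite -(subrK (s * r ^+ e) t); apply: idealD => //.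
have e1 : [set s | I (s * r ^+ e.+1)] = [set s | I (s * r ^+ e)].
  apply: emax; first by exists e.+1.
  by move=> x /= Ix; rewrite exprSr mulrA; exact: idealMr.
change ([set s | I (s * r ^+ e)] s); rewrite -e1 /= exprS.
have -> : s * (r * r ^+ e) = t * r - r * (t - s * r ^+ e) by ring.
by apply: idealB => //; [exact: colt | exact: idealMl].
Qed.

End Noetherian.

(** * Flatness *)

(** The ideal generated by the image of I.  Quantifying over all ideals that
    contain the image makes induction on its elements immediate. *)
Definition extension (S M : comPzRingType) (phi : S -> M) (I : set S) : set M :=
  [set v | forall K : set M, ideal K -> (forall a, I a -> K (phi a)) -> K v].

Section Extension.
Variables (S M : comPzRingType) (phi : S -> M) (I : set S).

Lemma extension_ideal : ideal (extension phi I).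
Proof.
split=> [K iK _|x y Ex Ey K iK IK|a x Ex K iK IK]; first exact: ideal0.
  by apply: idealD => //; [exact: Ex | exact: Ey].
by apply: idealMl => //; exact: Ex.
Qed.

Lemma mem_extension a : I a -> extension phi I (phi a).
Proof. by move=> Ia K _; apply. Qed.

End Extension.

Lemma restrict_scaleE (A B : comPzRingType) (f : {rmorphism A -> B}) a
    (x : restrict_scalars f) : a *: x = f a * (x : B).
Proof. by []. Qed.

(** M / IM as the tensor product of M and S / I: a bilinear map b is determined
    by h |-> b h 1, which vanishes on IM because the elements h' with
    b (h h') 1 = 0 for all h form an ideal that contains the image of I. *)
Section QuotientTensor.
Variables (S M : comPzRingType) (phi : {rmorphism S -> M}).
Variables (I : set S) (iI : ideal I).

Let iE : ideal (extension phi I). Proof. exact: extension_ideal. Qed.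
Definition quotient_module : lmodType S := restrict_scalars (coset iI).
Definition reduction_module : lmodType S :=
  restrict_scalars (coset iE \o phi : {rmorphism S -> quotient_ring iE}).

Definition reduction_tensor (h : restrict_scalars phi) (n : quotient_module)
  : reduction_module := coset iE (phi (rep (n : quotient_ring iI)) * (h : M)).

Lemma reduction_tensorE h a :
  reduction_tensor h (coset iI a : quotient_module) = coset iE (phi a * (h : M)).
Proof.
apply/coset_eq; rewrite -mulrBl -rmorphB; apply: idealMr iE _.
apply: mem_extension; exact: rep_coset.
Qed.

Lemma reduction_tensorP : is_tensor reduction_tensor.
Proof.
split.
  split=> [a h h' n|a h n n'].
    have [s ->] := coset_rep (n : quotient_ring iI).
    rewrite !reduction_tensorE !restrict_scaleE /= -rmorphM -rmorphD.
    by congr (coset iE _); rewrite mulrDr mulrCA.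
  have [s ->] := coset_rep (n : quotient_ring iI).
  have [s' ->] := coset_rep (n' : quotient_ring iI).
  rewrite restrict_scaleE -rmorphM -rmorphD !reduction_tensorE restrict_scaleE /=.
  rewrite -rmorphM -rmorphD; congr (coset iE _).
  by rewrite (rmorphD phi) (rmorphM phi); ring.
move=> Q b [bl br].
have bl0 n : b 0 n = 0 by have := bl (-1) 0 0 n; rewrite scaler0 addr0 scaleN1r addNr.
have br0 h : b h 0 = 0 by have := br (-1) h 0 0; rewrite scaler0 addr0 scaleN1r addNr.
have blD h h' n : b (h + h') n = b h n + b h' n by have := bl 1 h h' n; rewrite !scale1r.
have blZ a h n : b (a *: h) n = a *: b h n by have := bl a h 0 n; rewrite bl0 !addr0.
have brZ a h n : b h (a *: n) = a *: b h n by have := br a h n 0; rewrite br0 !addr0.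
pose one : quotient_module := coset iI 1.
have b_ext h : extension phi I h -> b h one = 0.
  move=> Eh; rewrite -[h]mul1r; move: 1 => h'; move: h' h Eh.
  suff : extension phi I `<=` [set h | forall h' : M, b (h' * h) one = 0].
    by move=> sub h' h /sub; apply.
  move=> h; apply.
    split=> [h'|x y Kx Ky h'|a x Kx h']; first by rewrite mulr0 bl0.
      by rewrite mulrDr blD Kx Ky addr0.
    by rewrite mulrA Kx.
  move=> a Ia h'; rewrite mulrC -(restrict_scaleE (f := phi)) blZ -brZ.
  rewrite restrict_scaleE /one -rmorphM mulr1 /=.
  have -> : coset iI a = 0 by apply/coset_eq0.
  exact: br0.
pose g (q : reduction_module) : Q := b (rep (q : quotient_ring iE)) one.
have gE (h : M) : g (coset iE h) = b h one.
  rewrite /g -[X in b X](subrK h) blD b_ext ?add0r //.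
  exact: rep_coset.
have g_lin : linear g.
  move=> a x y.
  have [h ->] := coset_rep (x : quotient_ring iE).
  have [h' ->] := coset_rep (y : quotient_ring iE).
  by rewrite restrict_scaleE /= -rmorphM -rmorphD !gE blD -(restrict_scaleE (f := phi)) blZ.
pose gM := GRing.isLinear.Build S reduction_module Q _ g g_lin.
pose G : {linear reduction_module -> Q} := HB.pack g gM.
exists G; split=> [h n|G' hG' x].
  have [a ->] := coset_rep (n : quotient_ring iI).
  rewrite reduction_tensorE /= gE -(restrict_scaleE (f := phi)) blZ -brZ.
  by rewrite restrict_scaleE /one -rmorphM mulr1.
have [h ->] := coset_rep (x : quotient_ring iE).
have e := hG' h one; rewrite reduction_tensorE rmorph1 mul1r in e.
by rewrite e /= gE.
Qed.

End QuotientTensor.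

(** Multiplication by t embeds S / m into S / I because (I : t) = m; tensoring
    with M gives the embedding of M / mM into M / IM. *)
Lemma flat_colon (S M : comPzRingType) (phi : {rmorphism S -> M}) (m I : set S)
    (t : S) :
  flat_hom phi -> ideal m -> ideal I -> (forall r, I (t * r) <-> m r) ->
  forall h, extension phi I (phi t * h) -> extension phi m h.
Proof.
move=> flat im iI colon h Eh.
pose f (x : quotient_module im) : quotient_module iI :=
  coset iI (t * rep (x : quotient_ring im)).
have fE r : f (coset im r) = coset iI (t * r).
  apply/coset_eq; rewrite -mulrBr; apply/colon; exact: (rep_coset im).
have f_lin : linear f.
  move=> a x y.
  have [r ->] := coset_rep (x : quotient_ring im).
  have [s ->] := coset_rep (y : quotient_ring im).
  rewrite !restrict_scaleE -rmorphM -rmorphD /= !fE -rmorphM -rmorphD /=.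
  by congr (coset iI _); ring.
have f_inj : injective f.
  move=> x y.
  have [r ->] := coset_rep (x : quotient_ring im).
  have [s ->] := coset_rep (y : quotient_ring im).
  rewrite !fE => /coset_eq h'; apply/coset_eq/colon.
  by rewrite mulrBr.
pose F : {linear quotient_module im -> quotient_module iI} :=
  HB.pack f (GRing.isLinear.Build S (quotient_module im) (quotient_module iI) _ f f_lin).
pose iEm := extension_ideal phi m; pose iEI := extension_ideal phi I.
have mulE (x : M) : extension phi m x -> extension phi I (phi t * x).
  move=> /(_ [set y | extension phi I (phi t * y)]); apply=> [|r mr].
    split=> /= [|y z|a y]; first by rewrite mulr0; exact: ideal0.
      by rewrite mulrDr; exact: idealD.
    by rewrite mulrCA; exact: idealMl.
  by rewrite /= -rmorphM /=; apply: mem_extension; apply/colon.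
pose g (x : reduction_module phi m) : reduction_module phi I :=
  coset iEI (phi t * rep (x : quotient_ring iEm)).
have gE y : g (coset iEm y) = coset iEI (phi t * y).
  apply/coset_eq; rewrite -mulrBr; apply: mulE; exact: rep_coset.
have g_lin : linear g.
  move=> a x y.
  have [r ->] := coset_rep (x : quotient_ring iEm).
  have [s ->] := coset_rep (y : quotient_ring iEm).
  rewrite !restrict_scaleE /= -rmorphM -rmorphD /= !gE -rmorphM -rmorphD /=.
  by congr (coset iEI _); ring.
pose G : {linear reduction_module phi m -> reduction_module phi I} :=
  HB.pack g (GRing.isLinear.Build S (reduction_module phi m) (reduction_module phi I) _ g g_lin).
have g_inj : injective G.
  apply: (flat _ _ F f_inj _ _ _ _ (reduction_tensorP phi im) (reduction_tensorP phi iI)).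
  move=> y n; have [r ->] := coset_rep (n : quotient_ring im).
  rewrite /= fE !reduction_tensorE gE rmorphM mulrA.
  by [].
apply/(coset_eq0 iEm); apply: g_inj; rewrite linear0 /= gE.
by apply/coset_eq0.
Qed.

(** A product of n elements of mM lies in (m ^ n) M.  By induction, in the form
    that (I : m ^ n) times such a product lies in IM. *)
Lemma extension_power (S M : comPzRingType) (phi : {rmorphism S -> M})
    (m I : set S) (n : nat) (s : seq M) :
  ideal I -> colon_power m I n 1 -> (n <= size s)%N ->
  (forall x, x \in s -> extension phi m x) -> extension phi I (\prod_(x <- s) x).
Proof.
move=> iI K1 le_ns sm.
suff /(_ 1 K1) : forall r, colon_power m I n r ->
  extension phi I (phi r * \prod_(x <- s) x) by rewrite rmorph1 mul1r.
elim: s n {K1} le_ns sm => [|x s IH] [|n] //= le_ns sm r Kr.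
- rewrite big_nil mulr1; exact: mem_extension.
- by apply: (idealMr _ (extension_ideal phi I)); exact: mem_extension.
rewrite big_cons; have : extension phi m x by apply: sm; rewrite mem_head.
move=> /(_ [set y | extension phi I (phi r * (y * \prod_(z <- s) z))]).
apply=> [|a ma].
  have iE := extension_ideal phi I.
  split=> /= [|y z|a y]; first by rewrite mul0r mulr0; exact: ideal0.
    by rewrite mulrDl mulrDr; exact: idealD.
  by move=> Ey; rewrite -mulrA mulrCA; apply: (idealMl _ iE).
rewrite /= mulrA -rmorphM /=; apply: (IH n) => //; last exact: Kr.
by move=> y ys; apply: sm; rewrite inE ys orbT.
Qed.

(** * The obstruction *)

(** Expand both sides of a + b = q + c, where c = a + b - q.  Only the two
    defects survive modulo J, and the defect of q and c is a multiple of q,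
    hence lies in J'. *)
Lemma frob_defect_congr (M : comPzRingType) (p n : nat) (J J' : set M) (a b q : M) :
  prime p -> ideal J -> ideal J' ->
  (forall x, J' x -> J (p%:R * x)) -> J' q ->
  J (q ^+ (p ^ n)) -> J (a ^+ (p ^ n)) -> J (b ^+ (p ^ n)) ->
  J ((a + b - q) ^+ (p ^ n)) -> J (p%:R * frob_defect p (p ^ n) a b).
Proof.
move=> pr_p iJ iJ' pJ' J'q Jq Ja Jb; set c := a + b - q => Jc.
have e : a + b = q + c by rewrite /c; ring.
have D := frob_defectE n a b pr_p; have D' := frob_defectE n q c pr_p.
rewrite e {}D' in D.
rewrite mulr_natl.
have -> : frob_defect p (p ^ n) a b *+ p =
    q ^+ (p ^ n) + c ^+ (p ^ n) + p%:R * frob_defect p (p ^ n) q c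
    - a ^+ (p ^ n) - b ^+ (p ^ n).
  by rewrite mulr_natl D -addrA -opprD addrC addKr.
do 2!apply: (idealB iJ) => //; apply: (idealD iJ); first exact: idealD.
apply: pJ'; rewrite /frob_defect big_nat; apply: ideal_sum => // i /andP[i0 _].
by rewrite -mulr_natl -(prednK i0) exprS -mulrA; do 1!apply: idealMl => //; apply: idealMr.
Qed.

Section DefectObstruction.
Variables (S M A A' : comPzRingType) (phi : {rmorphism S -> M}).
Variables (theta : {rmorphism M -> A'}) (j : {rmorphism A -> A'}).
Variables (m I : set S) (p e N L : nat).
Hypotheses (pr_p : prime p) (flat : flat_hom phi) (im : ideal m) (iI : ideal I).
Hypotheses (colon : forall r, I (p%:R * r) <-> m r) (mN : colon_power m I N 1).
Hypotheses (theta_lift : forall x, exists h, theta h = j x)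
  (theta_ker : forall h, theta h = 0 -> extension phi m h)
  (theta_m : forall r, m r -> theta (phi r) = 0).
Hypotheses (leNL : (N <= L)%N) (leNe : (N <= p ^ e)%N).

(** Each factor lifts to an element whose P-th power is in mM, so the P-th power
    of the product of the lifts is in (m ^ L) M. *)
Lemma lift_long_product a : long_nil_product L (p ^ e) a ->
  exists2 h, theta h = j a & extension phi I (h ^+ (p ^ e)).
Proof.
have [lift liftP] := choice theta_lift.
move=> [s [sz -> nil]]; exists (\prod_(x <- s) lift x).
  by rewrite !rmorph_prod; apply: eq_bigr.
rewrite -prodrXl -(big_map (fun x => lift x ^+ (p ^ e)) predT id).
apply: (extension_power iI mN); first by rewrite size_map sz.
move=> _ /mapP[x xs ->]; apply: theta_ker.
by rewrite rmorphXn liftP -rmorphXn nil // rmorph0.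
Qed.

(** With lifts a', b', c' of a, b, c and q = a' + b' - c' in mM, the congruence
    above puts p D(a', b') in IM, and flatness puts D(a', b') in mM. *)
Lemma defect_obstruction a b c : a + b = c ->
  long_nil_product L (p ^ e) a -> long_nil_product L (p ^ e) b ->
  long_nil_product L (p ^ e) c -> j (frob_defect p (p ^ e) a b) = 0.
Proof.
move=> abc /lift_long_product[a' a'E a'P] /lift_long_product[b' b'E b'P].
move=> /lift_long_product[c' c'E c'P].
have iEI := extension_ideal phi I; have iEm := extension_ideal phi m.
have theta_ext h : extension phi m h -> theta h = 0.
  move=> /(_ [set h | theta h = 0]); apply=> //.
  split=> /= [|x y ex ey|x y ey]; first exact: rmorph0.
    by rewrite rmorphD ex ey addr0.
  by rewrite rmorphM ey mulr0.
have Eq : extension phi m (a' + b' - c').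
  by apply: theta_ker; rewrite rmorphB rmorphD a'E b'E c'E -abc rmorphD subrr.
rewrite rmorph_frob_defect -a'E -b'E -rmorph_frob_defect; apply: theta_ext.
apply: (flat_colon flat im iI colon); rewrite rmorph_nat.
apply: (frob_defect_congr pr_p iEI iEm _ Eq) => //.
- move=> x /(_ [set x | extension phi I (p%:R * x)]); apply=> [|r mr].
    split=> /= [|y z|y z]; first by rewrite mulr0; exact: ideal0.
      by rewrite mulrDr; exact: idealD.
    by rewrite mulrCA; exact: idealMl.
  rewrite /= -(rmorph_nat phi) -rmorphM /=.
  by apply: mem_extension; apply/colon.
- move: {iEm} (a' + b' - c') Eq => q Eq.
  have -> : q ^+ (p ^ e) = \prod_(x <- nseq (p ^ e) q) x.
    by rewrite big_nseq iter_mulr_1.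
  apply: (extension_power iI mN); first by rewrite size_nseq.
  by move=> x /nseqP[->].
- by have -> : a' + b' - (a' + b' - c') = c' by ring.
Qed.

End DefectObstruction.

(** * Stalks of affine schemes and morphisms to them *)

Lemma unit_cancel (A : comPzRingType) (x y v b a : A) :
  v * b = 1 -> x * b = a -> y * b = a -> x = y.
Proof.
move=> vb xb yb; rewrite -[x]mulr1 -[y]mulr1 -vb ![v * b]mulrC !mulrA.
by rewrite xb yb.
Qed.

Section SpecStalk.
Variables (A : comPzRingType).
Implicit Types (P Q : spec A) (a b : A).

Let not1 (U : opens (spec A)) P : U P -> ~ P 1.
Proof. by move=> _; exact: prime1. Qed.
Definition spec_const (U : opens (spec A)) a : spec_section U :=
  const_sec a (@not1 U).

Lemma spec_constE (U : opens (spec A)) a P (UP : U P) : spec_const U a P UP = Defs.frac a (prime1 P).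
Proof. exact: frac_eq. Qed.

Definition stalk_const P a : stalk (P : spec_rs A) :=
  @germ (spec_rs A) P (opensT (spec A)) Logic.I (spec_const _ a).

Lemma spec_eval_const P a : spec_eval (stalk_const P a) = Defs.frac a (prime1 P).
Proof. by rewrite spec_evalE; exact: spec_constE. Qed.

Lemma frac_equal P (q : localization P) a b (nb : ~ P b) :
  q * Defs.frac b (prime1 P) = Defs.frac a (prime1 P) <-> q = Defs.frac a nb.
Proof.
have [c [d [nd ->]]] := frac_ex q.
rewrite (fracM _ _ nd (prime1 P) (primeM nd (prime1 P))).
by split=> /fracP[t [nt e]]; apply/fracP; exists t; split=> //; rewrite -e; ring.
Qed.

Lemma generization_open (U : opens (spec A)) P Q :
  U Q -> (P : set A) `<=` Q -> U P.
Proof.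
case: U => U /= /spec_openE[E ->] /= nQ sPQ sEP; apply: nQ.
exact: subset_trans sEP sPQ.
Qed.

Lemma spec_eval_inj P : injective (@spec_eval A P).
Proof.
move=> g h; have [U [UP [s [t [-> ->]]]]] := germ_common g h.
rewrite !spec_evalE => e; apply/germP.
have [V [hV [a [b [VP k]]]]] := spec_valP s UP.
have [W [hW [c [d [WP l]]]]] := spec_valP t UP.
have [nb ea] := k P VP; have [nd ec] := l P WP.
have UU : forall (U1 U2 : U P), (s : spec_section U) P U1 = (t : spec_section U) P U2.
  by move=> U1 U2; rewrite (Prop_irrelevance U1 UP) (Prop_irrelevance U2 UP).
move: (UU (hV P VP) (hW P WP)); rewrite ea ec => /fracP[u [nu eu]].
pose O := opensI (opensI V W) (basic_open u).
have OU : O `<=` U by move=> Q [[/hV]].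
exists O, OU, OU; split; first by [].
apply: spec_section_eq => Q [[VQ WQ] nuQ] /=.
have [nbQ eaQ] := k Q VQ; have [ndQ ecQ] := l Q WQ.
rewrite (Prop_irrelevance (OU Q _) (hV Q VQ)) eaQ.
rewrite (Prop_irrelevance (hV Q VQ) (hW Q WQ)) ecQ.
by apply/fracP; exists u.
Qed.

Lemma germ_spec_const (U : opens (spec A)) P (UP : U P) a :
  @germ (spec_rs A) P U UP (spec_const U a) = stalk_const P a.
Proof.
by apply: spec_eval_inj; rewrite spec_eval_const spec_evalE; exact: spec_constE.
Qed.

Lemma stalk_const_zmod P : zmod_morphism (stalk_const P).
Proof.
move=> a b; apply: spec_eval_inj.
rewrite spec_evalD.
have -> : spec_eval (- stalk_const P b) = - spec_eval (stalk_const P b).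
  by apply/eqP; rewrite -addr_eq0 -spec_evalD addNr spec_eval0.
rewrite !spec_eval_const fracN (fracD _ _ _ _ (primeM (prime1 P) (prime1 P))).
by apply: frac_eq; ring.
Qed.
Lemma stalk_const_monoid P : monoid_morphism (stalk_const P).
Proof.
split=> [|a b]; apply: spec_eval_inj.
  by rewrite spec_eval_const spec_eval1.
rewrite spec_evalM !spec_eval_const (fracM _ _ _ _ (primeM (prime1 P) (prime1 P))).
by apply: frac_eq; ring.
Qed.
HB.instance Definition _ P := GRing.isZmodMorphism.Build
  A (stalk (P : spec_rs A)) (stalk_const P) (stalk_const_zmod P).
HB.instance Definition _ P := GRing.isMonoidMorphism.Build
  A (stalk (P : spec_rs A)) (stalk_const P) (stalk_const_monoid P).

(** Open sets are stable under generization, so a neighbourhood of Q on which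
    the section is a single fraction contains all primes inside Q. *)
Lemma section_fraction (U : opens (spec A)) Q (s : spec_section U) : U Q ->
  exists a b, ~ Q b /\ forall P (UP : U P), (P : set A) `<=` Q ->
    @germ (spec_rs A) P U UP s * stalk_const P b = stalk_const P a.
Proof.
move=> UQ; have [V [hV [a [b [VQ k]]]]] := spec_valP s UQ.
have [nbQ _] := k Q VQ; exists a, b; split=> // P UP sPQ.
have VP := generization_open VQ sPQ; have [nb e] := k P VP.
apply: spec_eval_inj; rewrite spec_evalM !spec_eval_const spec_evalE.
by apply/(frac_equal _ a nb); rewrite -e (Prop_irrelevance (hV P VP) UP).
Qed.

Lemma stalk_fraction P (g : stalk (P : spec_rs A)) :
  exists a b, ~ P b /\ g * stalk_const P b = stalk_const P a.
Proof.
have [U [UP [s ->]]] := germ_ex g.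
by have [a [b [nb /(_ P UP)h]]] := section_fraction s UP; exists a, b; split=> //; apply: h.
Qed.

Lemma stalk_const_unit P b : ~ P b -> exists u, u * stalk_const P b = 1.
Proof.
move=> nb; have nU Q : basic_open b Q -> ~ Q b by [].
exists (@germ (spec_rs A) P (basic_open b) nb (const_sec 1 nU)).
apply: spec_eval_inj; rewrite spec_evalM spec_eval_const spec_evalE spec_eval1 frac_1.
by apply/(frac_equal _ 1 nb); exact: frac_eq.
Qed.

Lemma stalk_max_const P a : stalk_max (stalk_const P a) <-> P a.
Proof. by rewrite /stalk_max /= spec_eval_const; exact: loc_maxE. Qed.

Lemma stalk_max_unit P (g : stalk (P : spec_rs A)) : ~ stalk_max g ->
  exists v, v * g = 1.
Proof.
move=> ng; have [[iM _ _] _] := stalk_max_maximal P.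
have [a [b [nb e]]] := stalk_fraction g.
have [u eu] := stalk_const_unit nb.
have nPa : ~ P a.
  move=> Pa; apply: ng; apply: (ideal_inverse iM eu).
  by rewrite e; apply/stalk_max_const.
have [v ev] := stalk_const_unit nPa; exists (v * stalk_const P b).
by rewrite -mulrA [stalk_const P b * g]mulrC e.
Qed.

Lemma stalk_const_eq0 P a : stalk_const P a = 0 -> exists t, ~ P t /\ t * a = 0.
Proof.
move=> e; have : spec_eval (stalk_const P a) = spec_eval (stalk_const P 0).
  by rewrite e rmorph0.
rewrite !spec_eval_const => /fracP[t [nt et]]; exists t; split=> //.
by rewrite mulr1 mul0r subr0 in et.
Qed.

End SpecStalk.

Lemma stalk_map_comp (X Y Z : lrspace) (g : lr_mor Y Z) (f : lr_mor X Y) (x : X)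
    (s : stalk (g (f x))) :
  stalk_map (lr_comp g f) x s = stalk_map f x (stalk_map g (f x) s).
Proof.
have [V [Vx [t ->]]] := germ_ex s.
rewrite (stalk_mapE (f := lr_comp g f) _ (Vx : (lr_comp g f ^-1o V) x)) /=.
rewrite (stalk_mapE _ (Vx : (g ^-1o V) (f x))).
by rewrite (stalk_mapE _ (Vx : (f ^-1o (g ^-1o V)) x)) germ_res.
Qed.

(** The sheaf axiom: equal germs give equality on an open cover. *)
Lemma eq_germ (X : ringed_space) (U : opens X) (s t : sec U) :
  (forall x (Ux : U x), germ Ux s = germ Ux t) -> s = t.
Proof.
move=> e; pose W (x : {x | U x}) : opens X :=
  projT1 (cid (proj1 (germP _ _ _ _) (e _ (proj2_sig x)))).
have WP x : exists (h : W x `<=` U), W x (proj1_sig x) /\ res h s = res h t.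
  rewrite /W; case: cid => V /= [h [h' [Vx e']]]; exists h; split=> //.
  by rewrite e' (Prop_irrelevance h' h).
have hW x : W x `<=` U by have [] := WP x.
apply: (sheaf_sep (V := W) (hV := hW)).
  by move=> x Ux; exists (exist _ x Ux) => //; have [_ [Wx _]] := WP (exist _ x Ux); exact: Wx.
move=> x; have [h [_ e']] := WP x.
by rewrite (Prop_irrelevance (hW x) h).
Qed.

Lemma stalk_map_section_eq (X Y : lrspace) (f : lr_mor X Y) (x : X)
    (V : opens Y) (Vfx : V (f x)) (s : sec V) (b a : stalk (f x)) (b' a' : stalk x) :
  stalk_map f x b = b' -> stalk_map f x a = a' -> germ Vfx s * b = a ->
  germ (Vfx : (f ^-1o V) x) (pull f V s) * b' = a'.
Proof. by move=> <- <- <-; rewrite rmorphM /= (stalk_mapE _ Vfx). Qed.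

Section MapsToSpec.
Variables (T : lrspace) (R : comPzRingType).
Implicit Types f g : lr_mor T (Spec R).

(** The pullback of the global function r, as a germ at t.  These germs live in
    the stalks of T, so they can be compared for two morphisms that are not known
    to agree on points. *)
Definition pull_const g (t : T) : {rmorphism R -> stalk t} :=
  stalk_map g t \o stalk_const (g t : spec R).

Lemma pull_const_germ g t r :
  pull_const g t r =
  @germ T t (g ^-1o opensT (Spec R)) Logic.I (pull g (opensT (Spec R)) (spec_const _ r)).
Proof. exact: (@stalk_mapE _ _ g t (opensT (Spec R)) Logic.I Logic.I). Qed.

(** The map on stalks is local: r lies in the prime g t when its germ there is
    not a unit, that is, when the pulled back germ is not a unit. *)
Lemma mem_map_to_spec g t r (N : set (stalk t)) : maximal_ideal N ->
  (g t : spec R) r <-> N (pull_const g t r).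
Proof.
move=> maxN; have [maxP _] := stalk_max_maximal (g t : spec R).
have e := @lr_local T (Spec R) g t _ _ maxP maxN.
rewrite -stalk_max_const -e.
by [].
Qed.

Lemma eq_mor_pull_const f g t r : eq_mor f g -> pull_const f t r = pull_const g t r.
Proof.
move=> [_ /(_ (opensT (Spec R)))]; rewrite !pull_const_germ.
have h : f ^-1o opensT (Spec R) `<=` g ^-1o opensT (Spec R) by [].
by move=> /(_ h (spec_const _ r)) <-; exact: germ_res.
Qed.

(** A morphism to an affine scheme is determined by the pullbacks of the global
    functions: the points are recovered by locality, and a section that is the
    fraction a / b near g t pulls back to the quotient of the pullbacks of a and
    b. *)
Lemma eq_mor_to_spec f g :
  (forall t r, pull_const f t r = pull_const g t r) -> eq_mor f g.
Proof.
move=> e.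
have pts t : f t = g t.
  apply: spec_eq; apply/seteqP.
  have [N [maxN _]] := stalk_local t.
  by split=> r; rewrite (mem_map_to_spec f r maxN) (mem_map_to_spec g r maxN) e.
split=> // V h s; apply: eq_germ => t Vft.
have Vgt : V (g t) := h t Vft.
rewrite (germ_res (Vgt : (g ^-1o V) t)).
have [a [b [nb eb]]] := section_fraction (s : spec_section V) Vgt.
have /(@stalk_map_section_eq T (Spec R) g t V Vgt s _ _ _ _ erefl erefl) eg :=
  eb (g t : spec R) Vgt (@subset_refl _ _).
have sub : (f t : spec R) `<=` (g t : spec R) by rewrite pts.
have /(@stalk_map_section_eq T (Spec R) f t V Vft s _ _ _ _ erefl erefl) ef :=
  eb (f t : spec R) Vft sub.
have [v ev] : exists v, v * pull_const g t b = 1.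
  have [u eu] := stalk_const_unit nb.
  by exists (stalk_map g t u); rewrite -rmorphM eu rmorph1.
have {}eg : germ (Vgt : (g ^-1o V) t) (pull g V s) * pull_const g t b = pull_const g t a := eg.
have {}ef : germ Vft (pull f V s) * pull_const f t b = pull_const f t a := ef.
rewrite (e t b) (e t a) in ef.
exact: unit_cancel ev eg ef.
Qed.

End MapsToSpec.

Lemma pull_const_comp (X Y : lrspace) (R : comPzRingType) (g : lr_mor Y (Spec R))
    (f : lr_mor X Y) (x : X) (r : R) :
  pull_const (lr_comp g f) x r = stalk_map f x (pull_const g (f x) r).
Proof. exact: (@stalk_map_comp X Y (Spec R)). Qed.

Lemma pull_const_Spec_map (A B : comPzRingType) (phi : {rmorphism A -> B})
    (P : spec B) (a : A) :
  pull_const (Spec_map phi) (P : Spec B) a = stalk_const P (phi a).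
Proof.
rewrite pull_const_germ; apply: spec_eval_inj.
rewrite spec_eval_const spec_evalE /=.
rewrite (loc_mapE (phi := phi) (Q := P)).
by apply: frac_eq; rewrite rmorph1.
Qed.

Lemma pull_const_Spec_map_comp (A B C : comPzRingType) (f : {rmorphism A -> B})
    (g : {rmorphism B -> C}) (P : spec C) (a : A) :
  pull_const (lr_comp (Spec_map f) (Spec_map g)) (P : Spec C) a =
  stalk_const P (g (f a)).
Proof.
rewrite pull_const_comp -pull_const_Spec_map.
congr (stalk_map _ _ _); exact: pull_const_Spec_map.
Qed.

Lemma stalk_map_Spec_map (A B : comPzRingType) (phi : {rmorphism A -> B})
    (P : spec B) (a : A) :
  stalk_map (Spec_map phi) (P : Spec B) (stalk_const (spec_comap phi P) a) =
  stalk_const P (phi a).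
Proof. exact: pull_const_Spec_map. Qed.

(** The fractions below are written as equations g * b = a, and pushed along
    stalk maps in this form. *)
Lemma stalk_map_fraction (X Y : lrspace) (f : lr_mor X Y) (x : X)
    (g b a : stalk (f x)) (b' a' : stalk x) :
  stalk_map f x b = b' -> stalk_map f x a = a' -> g * b = a ->
  stalk_map f x g * b' = a'.
Proof. by move=> <- <- <-; rewrite rmorphM. Qed.

Lemma stalk_map_res (X Y : lrspace) (f : lr_mor X Y) (x : X) (U : opens X)
    (Ux : U x) (W : opens Y) (Wfx : W (f x)) (h : f ^-1o W `<=` U) (t : sec W)
    (s : sec U) :
  pull f W t = res h s -> stalk_map f x (germ Wfx t) = germ Ux s.
Proof. by move=> e; rewrite (stalk_mapE _ Wfx) e; exact: germ_res. Qed.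

Lemma germ0_fraction (X : ringed_space) (x : X) (U : opens X) (Ux : U x)
    (s : sec U) (b a : stalk x) : s = 0 -> germ Ux s * b = a -> a = 0.
Proof. by move=> -> <-; rewrite germ_0 mul0r. Qed.

Lemma pull_const_fraction (R B : comPzRingType) (F : lr_mor (Spec B) (Spec R))
    (Q : spec B) (r : R) :
  exists a b, ~ Q b /\ forall P : spec B, (P : set B) `<=` Q ->
    pull_const F (P : Spec B) r * stalk_const P b = stalk_const P a.
Proof.
pose U : opens (spec B) := F ^-1o opensT (Spec R).
pose s : spec_section U := pull F (opensT (Spec R)) (spec_const _ r).
have [a [b [nb sab]]] := @section_fraction B U Q s Logic.I.
exists a, b; split=> // P sPQ.
apply: (@eq_trans _ _ (@germ (spec_rs B) P U Logic.I s * stalk_const P b)).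
  exact: (congr1 (fun g : stalk (P : spec_rs B) => g * stalk_const P b)
    (pull_const_germ F (P : Spec B) r)).
exact: sab.
Qed.

Lemma res_eq0 (X : ringed_space) (U V : opens X) (h : V `<=` U) (s : sec U) :
  U `<=` V -> res h s = 0 -> s = 0.
Proof.
move=> h' e; rewrite -(res_id (@subset_refl _ U) s) -(res_comp h h') e.
exact: rmorph0.
Qed.

(** An open immersion induces bijections on stalks: the image W' of an open W is
    open, its preimage is W, and sections over W' and W correspond. *)
Section OpenImmersion.
Variables (X Y : lrspace) (j : lr_mor X Y).
Hypothesis oj : open_immersion j.

Let image_open (W : opens X) : opens Y := Opens (let: And3 _ o _ := oj in o W (osetP W)).
Let image_le W : j ^-1o (image_open W) `<=` W.
Proof. by move=> x [x' Wx' e]; have [inj _ _] := oj; rewrite -(inj _ _ e). Qed.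
Let image_ge (W : opens X) : W `<=` j ^-1o (image_open W).
Proof. by move=> x Wx; exists x. Qed.
Let image_bij W : bijective (pull j (image_open W)).
Proof. by have [_ _] := oj; apply => y [x _ <-]; exists x. Qed.

Lemma open_immersion_stalk_inj x (g : stalk (j x)) : stalk_map j x g = 0 -> g = 0.
Proof.
have [V [Vx [s ->]]] := germ_ex g.
rewrite (stalk_mapE _ (Vx : (j ^-1o V) x)) -(germ_0 (Vx : (j ^-1o V) x)).
move=> /germP[W [hW [hW' [Wx e]]]].
have hV : image_open W `<=` V by move=> _ [x' Wx' <-]; exact: (hW x' Wx').
rewrite -(germ_res Vx (image_ge Wx) hV s).
suff -> : res hV s = 0 by exact: germ_0.
have h' : j ^-1o (image_open W) `<=` j ^-1o V by move=> x' /image_le /hW.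
apply: (bij_inj (image_bij W)); rewrite -(pull_res hV h') rmorph0.
rewrite rmorph0 in e.
by rewrite -(res_comp hW (@image_le W)) e rmorph0.
Qed.

Lemma open_immersion_stalk_surj x (g : stalk x) : exists h, g = stalk_map j x h.
Proof.
have [W [Wx [s ->]]] := germ_ex g.
have [b bK Kb] := image_bij W.
exists (germ (image_ge Wx : image_open W (j x)) (b (res (@image_le W) s))).
by rewrite (stalk_mapE _ (image_ge Wx)) Kb (germ_res Wx).
Qed.

End OpenImmersion.

(** R / ker pi = k, so a map that sends ker pi into J descends to k. *)
Lemma factor_through (R k L : comPzRingType) (pi : {rmorphism R -> k})
    (pi_surj : forall y, exists x, pi x = y) (psi : {rmorphism R -> L})
    (J : set L) (iJ : ideal J) :
  (forall r, pi r = 0 -> J (psi r)) ->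
  exists kappa : {rmorphism k -> quotient_ring iJ},
    forall r, kappa (pi r) = coset iJ (psi r).
Proof.
move=> Jker; have [c cP] := choice pi_surj.
pose kappa y : quotient_ring iJ := coset iJ (psi (c y)).
have kappaE r : kappa (pi r) = coset iJ (psi r).
  by apply/coset_eq; rewrite -rmorphB; apply: Jker; rewrite rmorphB cP subrr.
have zmodP : zmod_morphism kappa.
  move=> x y; rewrite -(cP x) -(cP y) -rmorphB !kappaE.
  by rewrite -rmorphB -rmorphB.
have monoidP : monoid_morphism kappa.
  split=> [|x y]; first by rewrite -(rmorph1 pi) kappaE !rmorph1.
  rewrite -(cP x) -(cP y) -rmorphM !kappaE.
  by rewrite -rmorphM -rmorphM.
pose zM := GRing.isZmodMorphism.Build k (quotient_ring iJ) kappa zmodP.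
pose mM := GRing.isMonoidMorphism.Build k (quotient_ring iJ) kappa monoidP.
pose K : {rmorphism k -> quotient_ring iJ} := HB.pack kappa zM mM.
by exists K.
Qed.

(** * A test object for the fibre product *)

(** For a point Q of Spec B over the closed point of Spec R, the test object is
    the spectrum of C = L / mL, where L is the stalk at Q. *)
Section AffineFiber.
Variables (R k : comPzRingType) (pi : {rmorphism R -> k}).
Hypothesis pi_surj : forall y, exists x, pi x = y.
Variables (B : comPzRingType) (F : lr_mor (Spec B) (Spec R)) (Q : spec B).
Hypothesis FQ : forall r, (F Q : spec R) r <-> pi r = 0.

Let ker : set R := [set r | pi r = 0].
Let L : comPzRingType := stalk (Q : spec_rs B).
Let psi : {rmorphism R -> L} := pull_const F (Q : Spec B).
Let J : set L := extension psi ker.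
Let iJ : ideal J. Proof. exact: extension_ideal. Qed.
Let C : comPzRingType := quotient_ring iJ.
Let q : {rmorphism B -> C} := coset iJ \o stalk_const Q.

Let factor := 
  @factor_through R k L pi pi_surj psi J iJ (fun r => @mem_extension _ _ psi ker r).
Let psi_lift : {rmorphism k -> C} := projT1 (cid factor).
Let psi_liftE r : psi_lift (pi r) = coset iJ (psi r).
Proof. exact: (projT2 (cid factor)). Qed.

Let maxL : maximal_ideal (stalk_max (P := Q)).
Proof. by have [] := stalk_max_maximal Q. Qed.

Let J_max : J `<=` stalk_max (P := Q).
Proof.
have [iM _ _] := maxL.
move=> l /(_ _ iM); apply => r /FQ.
exact: (proj1 (mem_map_to_spec F r maxL)).
Qed.

Let unit_q b : ~ Q b -> exists u, u * q b = 1.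
Proof.
move=> /stalk_const_unit[u eu]; exists (coset iJ u).
by rewrite -rmorphM eu rmorph1.
Qed.

Let fiber_sub (t : spec C) : (spec_comap q t : set B) `<=` Q.
Proof.
move=> b tb; apply: contrapT => /unit_q[u eu].
have [it nt1 _] := sprimeP t; apply: nt1; rewrite -eu.
exact: idealMl.
Qed.

(** Both composites are compared on global functions.  The pullback of r to
    Spec B is one fraction a / b at Q and at all primes inside Q, in particular
    at the images of the points of Spec C. *)
Let fiber_square :
  eq_mor (lr_comp F (Spec_map q)) (lr_comp (Spec_map pi) (Spec_map psi_lift)).
Proof.
apply: eq_mor_to_spec => t r.
have -> : pull_const (lr_comp (Spec_map pi) (Spec_map psi_lift)) t r =
    stalk_const t (coset iJ (psi r)).
  by rewrite pull_const_Spec_map_comp psi_liftE.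
rewrite pull_const_comp.
have [a [b [nb sab]]] := pull_const_fraction F Q r.
have eQ : psi r * stalk_const Q b = stalk_const Q a := sab Q (@subset_refl _ _).
have [u eu] := unit_q nb.
apply: (@unit_cancel _ _ _ (stalk_const t u) (stalk_const t (q b)) (stalk_const t (q a))).
- by rewrite -rmorphM eu rmorph1.
- exact: (stalk_map_fraction (stalk_map_Spec_map q t b) (stalk_map_Spec_map q t a)
    (sab (spec_comap q t) (@fiber_sub t))).
- by rewrite -rmorphM -rmorphM eQ.
Qed.

(** The closed point of Spec C.  Elements of C outside it are units, so
    vanishing in the local ring there means vanishing in C. *)
Let closed_prime : prime_ideal [set c : C | forall l, coset iJ l = c -> stalk_max l].
Proof.
have [iM nM1 _] := maxL.
have sat l : [set c : C | forall l, coset iJ l = c -> stalk_max l] (coset iJ l) <->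
    stalk_max l.
  split=> [|Ml l' /coset_eq/J_max h]; first exact.
  by rewrite -(subrK l l'); exact: idealD.
split.
- split=> [|x y|x y].
  + by rewrite -(rmorph0 (coset iJ)); apply/sat; exact: ideal0.
  + have [l ->] := coset_rep x; have [l' ->] := coset_rep y.
    by rewrite -rmorphD => /sat Ml /sat Ml'; apply/sat; exact: idealD.
  + have [l ->] := coset_rep x; have [l' ->] := coset_rep y.
    by rewrite -rmorphM => /sat Ml'; apply/sat; exact: idealMl.
- by rewrite -(rmorph1 (coset iJ)) => /sat.
- move=> x y; have [l ->] := coset_rep x; have [l' ->] := coset_rep y.
  rewrite -rmorphM => /sat Mll'.
  have [Ml|/stalk_max_unit[v ev]] := pselect (stalk_max l); first by left; apply/sat.
  right; apply/sat; have -> : l' = v * (l * l') by rewrite mulrA ev mul1r.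
  exact: idealMl.
Qed.

Lemma affine_fiber_test :
  exists (C' : comPzRingType) (a : lr_mor (Spec C') (Spec B))
         (b : lr_mor (Spec C') (Spec k)),
    eq_mor (lr_comp F a) (lr_comp (Spec_map pi) b) /\
    forall (U : opens (Spec B)) (UQ : U Q) (s : sec U), pull a U s = 0 ->
      extension (pull_const F (Q : Spec B)) [set r | pi r = 0] (germ UQ s).
Proof.
exists C, (Spec_map q), (Spec_map psi_lift); split; first exact: fiber_square.
move=> U UQ s s0; change (J (germ UQ s)).
pose t : spec C := SpecPoint closed_prime.
have tU : U (Spec_map q t) by apply: generization_open UQ _; exact: fiber_sub.
have [a [b [nb sab]]] := section_fraction (s : spec_section U) UQ.
have [u eu] := stalk_const_unit nb.
apply: (ideal_inverse iJ eu).
refine (eq_ind_r J _ (sab Q UQ (@subset_refl _ _))).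
have /(stalk_map_section_eq (f := Spec_map q) (stalk_map_Spec_map q t b)
  (stalk_map_Spec_map q t a)) := sab (spec_comap q t) tU (@fiber_sub t).
move=> /(germ0_fraction s0)/stalk_const_eq0[c [nc]].
move=> ca0; apply: contrapT => nJa; apply: nc => l ec; apply: contrapT.
move=> /stalk_max_unit[v ev]; apply: nJa; apply: (ideal_inverse iJ ev).
by rewrite mulrC; apply/(coset_eq0 iJ); rewrite rmorphM /= ec.
Qed.

End AffineFiber.

Lemma extension_transfer (R L S M : comPzRingType) (psi : R -> L) (phi : S -> M)
    (c : R -> S) (e : {rmorphism M -> L}) (K : set R) (m : set S) (h : M) :
  (forall x, e x = 0 -> x = 0) -> (forall l, exists x, l = e x) ->
  (forall r, e (phi (c r)) = psi r) -> (forall r, K r -> m (c r)) ->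
  extension psi K (e h) -> extension phi m h.
Proof.
move=> e_inj e_surj ce cK.
have inj x y : e x = e y -> x = y.
  by move=> exy; apply/subr0_eq/e_inj; rewrite rmorphB exy subrr.
have iE := extension_ideal phi m.
move=> /(_ [set l | forall x, e x = l -> extension phi m x]); apply=> //.
  split=> [x|l l' El El' x|l l' El' x].
  - by move/e_inj ->; exact: ideal0.
  - have [y ey] := e_surj l; have [y' ey'] := e_surj l'.
    rewrite ey ey' -rmorphD => /inj ->.
    exact: idealD iE (El y (esym ey)) (El' y' (esym ey')).
  - have [y ey] := e_surj l; have [y' ey'] := e_surj l'.
    rewrite ey ey' -rmorphM => /inj ->.
    exact: idealMl iE (El' y' (esym ey')).
by move=> r Kr x; rewrite -ce => /inj ->; apply: mem_extension; exact: cK.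
Qed.

Lemma lr_compA_pull_const (W X Y : lrspace) (R : comPzRingType)
    (f : lr_mor Y (Spec R)) (j : lr_mor X Y) (a : lr_mor W X) (t : W) (r : R) :
  pull_const (lr_comp f (lr_comp j a)) t r =
  pull_const (lr_comp (lr_comp f j) a) t r.
Proof.
apply: etrans (pull_const_comp f (lr_comp j a) t r) _.
apply: etrans (stalk_map_comp (g := j) (f := a) (pull_const f (j (a t)) r)) _.
apply: etrans _ (esym (pull_const_comp (lr_comp f j) a t r)).
exact: (congr1 (stalk_map a t) (esym (pull_const_comp f j (a t) r))).
Qed.

(** The test object of an affine chart around y, seen over Xt.  Passing to the
    stalk of the chart loses nothing, since the chart is an open immersion. *)
Lemma fiber_test (R k : comPzRingType) (pi : {rmorphism R -> k})
    (Xt : sch_over (Spec R)) (y : Xt) :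
  (forall z, exists r, pi r = z) ->
  (forall r, (structure Xt y : spec R) r <-> pi r = 0) ->
  exists (C : comPzRingType) (a : lr_mor (Spec C) Xt) (b : lr_mor (Spec C) (Spec k)),
    eq_mor (lr_comp (structure Xt) a) (lr_comp (Spec_map pi) b) /\
    forall (V : opens Xt) (Vy : V y) (s : sec V), pull a V s = 0 ->
      extension (stalk_map (structure Xt) y)
        (stalk_max (P := structure Xt y)) (germ Vy s).
Proof.
move=> pi_surj; have [B [j [oj [Q _ <-]]]] := @sch_affine Xt y.
set f := structure Xt => fy; pose F := lr_comp f j.
have [C [a [b [sq test]]]] := @affine_fiber_test R k pi pi_surj B F Q fy.
exists C, (lr_comp j a), b; split.
  apply: eq_mor_to_spec => t r; rewrite lr_compA_pull_const.
  exact: eq_mor_pull_const.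
move=> V Vy s s0.
have {}s0 : pull a (j ^-1o V) (pull j V s) = 0.
  have [h e] : exists h : lr_comp j a ^-1o V `<=` a ^-1o (j ^-1o V),
      res h (pull a (j ^-1o V) (pull j V s)) = 0 by eexists; exact: s0.
  exact: res_eq0 e.
have := test (j ^-1o V) Vy _ s0.
rewrite -(stalk_mapE (f := j) Vy Vy s).
apply: (@extension_transfer _ _ _ _ _ _ (stalk_const (f (j Q) : spec R))).
- exact: open_immersion_stalk_inj.
- exact: open_immersion_stalk_surj.
- move=> r; exact: (esym (pull_const_comp f j (Q : Spec B) r)).
- by move=> r /fy; rewrite stalk_max_const.
Qed.

(** * One-point spectra *)

Section OnePoint.
Variables (k : fieldType) (A : comNzRingType) (iota : {rmorphism k -> A}).
Hypothesis augA : nil_augmented iota.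

Let nil_prime (P : spec A) x : (exists n, x ^+ n = 0) -> P x.
Proof.
have [iP nP1 pP] := sprimeP P => -[n xn].
have : P (x ^+ n) by rewrite xn; exact: ideal0.
elim: n {xn} => [|n IH]; first by [].
by rewrite exprS => /pP[|/IH].
Qed.

(** The scalar part of an element is unique, since a nilpotent scalar is zero; so
    taking scalar parts is a ring homomorphism. *)
Lemma augmentation : exists2 eps : {rmorphism A -> k}, 
  cancel iota eps & forall x, exists n, (x - iota (eps x)) ^+ n = 0.
Proof.
have [e eP] := choice augA.
have nil0 c : (exists n, iota c ^+ n = 0) -> c = 0.
  by move=> [n /eqP]; rewrite -rmorphXn fmorph_eq0 expf_eq0 => /andP[_ /eqP].
have uniq x c : (exists n, (x - iota c) ^+ n = 0) -> e x = c.
  move=> hc; apply/esym/subr0_eq/nil0; rewrite rmorphB.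
  have -> : iota c - iota (e x) = (x - iota (e x)) + (-1) * (x - iota c) by ring.
  by apply: nilpotentD => //; exact: nilpotentMl.
have zmodP : zmod_morphism e.
  move=> x y; apply: uniq.
  have -> : x - y - iota (e x - e y) = (x - iota (e x)) + (-1) * (y - iota (e y)).
    by rewrite rmorphB; ring.
  by apply: nilpotentD => //; exact: nilpotentMl.
have monoidP : monoid_morphism e.
  split=> [|x y]; apply: uniq; first by exists 1%N; rewrite rmorph1 subrr.
  have -> : x * y - iota (e x * e y) = y * (x - iota (e x)) + iota (e x) * (y - iota (e y)).
    by rewrite rmorphM; ring.
  by apply: nilpotentD; apply: nilpotentMl.
pose eps : {rmorphism A -> k} := HB.pack e
  (GRing.isZmodMorphism.Build A k e zmodP) (GRing.isMonoidMorphism.Build A k e monoidP).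
exists eps => // c; apply: uniq.
by exists 1%N; rewrite subrr.
Qed.

Lemma nil_augmented_prime (eps : {rmorphism A -> k}) (P : spec A) x :
  cancel iota eps -> (forall x, exists n, (x - iota (eps x)) ^+ n = 0) ->
  P x <-> eps x = 0.
Proof.
move=> epsK epsN; have [iP nP1 _] := sprimeP P; split=> [Px|ex]; last first.
  by apply: nil_prime; have := epsN x; rewrite ex rmorph0 subr0.
apply/eqP; apply: contrapT => /negP ex; apply: nP1.
have Pe : P (iota (eps x)).
  rewrite -(subKr x (iota (eps x))); apply: idealB => //.
  exact: nil_prime.
rewrite -(rmorph1 iota) -(mulVf ex) rmorphM; exact: idealMl.
Qed.

Lemma nil_augmented_spec_eq (P Q : spec A) : P = Q.
Proof.
have [eps epsK epsN] := augmentation.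
apply: spec_eq; apply/seteqP; split=> x.
  by move/(nil_augmented_prime _ _ epsK epsN)/(nil_augmented_prime Q _ epsK epsN).
by move/(nil_augmented_prime _ _ epsK epsN)/(nil_augmented_prime P _ epsK epsN).
Qed.

Lemma nil_augmented_point : exists P : spec A, forall c, P (iota c) <-> c = 0.
Proof.
have [eps epsK epsN] := augmentation.
have pP : prime_ideal [set x | eps x = 0].
  split=> [|/=|x y /=]; last 2 first.
  - by rewrite rmorph1; apply/eqP/oner_neq0.
  - by rewrite rmorphM => /eqP; rewrite mulf_eq0 => /orP[]/eqP; [left|right].
  split=> /= [|x y ex ey|a x ex]; first exact: rmorph0.
    by rewrite rmorphD ex ey addr0.
  by rewrite rmorphM ex mulr0.
by exists (SpecPoint pP) => c /=; rewrite epsK.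
Qed.

(** If t = c + nu with c a nonzero scalar and nu nilpotent, then t a = 0 gives
    c ^ n a = (- nu) ^ n a = 0. *)
Lemma nil_augmented_stalk_inj (P : spec A) a : stalk_const P a = 0 -> a = 0.
Proof.
have [eps epsK epsN] := augmentation.
move=> /stalk_const_eq0[t [nPt ta]].
have et : eps t != 0 by apply/eqP => /(nil_augmented_prime P _ epsK epsN).
have [n nu0] := epsN t; set nu := t - _ in nu0.
have step i : iota (eps t) ^+ i * a = (- nu) ^+ i * a.
  elim: i => [|i IH]; first by rewrite !expr0.
  rewrite !exprS -!mulrA IH mulrCA [RHS]mulrCA; congr (_ * _).
  by rewrite /nu opprB mulrBl ta subr0.
have := step n; rewrite exprNn nu0 mulr0 mul0r -rmorphXn.
move=> /(congr1 (fun x => iota ((eps t ^+ n)^-1) * x)).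
by rewrite mulr0 mulrA -rmorphM mulVf ?rmorph1 ?mul1r // expf_neq0.
Qed.

End OnePoint.

Lemma one_point_krull_dim (X : topologicalType) (x : X) :
  (forall y : X, y = x) -> krull_dim X 0.
Proof.
move=> X1; split.
  exists (fun _ => setT); split=> // i _; split; first exact: closedT.
  split=> [|F G _ _ /(_ x I)[Fx|Gx]]; first by exists x.
    by left=> y _; rewrite (X1 y).
  by right=> y _; rewrite (X1 y).
move=> [|d] // [Z [irr lt]].
have [_ [[y Zy] _]] := irr 0%N isT.
have [_ nsub] := lt 0%N isT; case: nsub => z _; rewrite (X1 z) -(X1 y).
exact: Zy.
Qed.


(** * Lifts of one-point schemes *)

Lemma fraction_eq0 (A B C : comPzRingType) (f : {rmorphism A -> B})
    (g : {rmorphism B -> C}) (r b a u : A) :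
  u * b = 1 -> r * b = a -> g (f a) = 0 -> g (f r) = 0.
Proof.
move=> ub rb ga; have -> : r = a * u by rewrite -rb -mulrA [b * u]mulrC ub mulr1.
by rewrite !rmorphM ga mul0r.
Qed.

Section ResidueStalk.
Variables (R : comPzRingType) (k : fieldType) (pi : {rmorphism R -> k}).
Hypotheses (noethR : noetherian R) (localR : local_ring R).
Hypothesis pi_surj : forall y, exists x, pi x = y.

Let ker_ideal : ideal [set r | pi r = 0].
Proof.
split=> /= [|x y ex ey|a x ex]; first exact: rmorph0.
  by rewrite rmorphD ex ey addr0.
by rewrite rmorphM ex mulr0.
Qed.

Let ker_maximal : maximal_ideal [set r | pi r = 0].
Proof.
split=> // [|I iI nI1 sub].
  by rewrite /= rmorph1; apply/eqP/oner_neq0.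
apply/seteqP; split=> // x Ix /=; apply/eqP; apply: contrapT => /negP ex; apply: nI1.
have [y ey] := pi_surj (pi x)^-1.
rewrite -(subrK (y * x) 1); apply: idealD => //; last exact: idealMl.
by apply: sub; rewrite /= rmorphB rmorphM ey mulVf // rmorph1 subrr.
Qed.

Let ker_prime : prime_ideal [set r | pi r = 0].
Proof.
split=> //= [|x y]; first by rewrite rmorph1; apply/eqP/oner_neq0.
by rewrite rmorphM => /eqP; rewrite mulf_eq0 => /orP[]/eqP; [left|right].
Qed.

Let unit_off_ker r : pi r <> 0 -> exists u, u * r = 1.
Proof.
have [M [_ uM]] := localR.
have uker m' : maximal_ideal m' -> [set r | pi r = 0] = m'.
  by move=> /uM <-; rewrite (uM _ ker_maximal).
exact: (local_noetherian_unit noethR uker (x := r)).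
Qed.

(** The stalk at the closed point is a quotient of R, hence noetherian, and
    [separating_primary_ideal] applies to it.  N is found at one point; stating
    the conclusion for every P with the same underlying prime lets it be used at
    the image of a point of a lift, which is equal to that point only
    propositionally. *)
Lemma residue_stalk_primary (t : R) : t <> 0 ->
  exists N, forall P : spec R, (forall r, P r <-> pi r = 0) ->
    exists I : set (stalk (P : spec_rs R)),
      [/\ ideal I, forall g, I (stalk_const P t * g) <-> stalk_max g &
          colon_power (stalk_max (P := P)) I N 1].
Proof.
move=> t0; pose P0 : spec R := SpecPoint ker_prime.
have [max0 uniq0] := stalk_max_maximal P0.
have surj (g : stalk (P0 : spec_rs R)) : exists a, g = stalk_const P0 a.
  have [a [b [nb e]]] := stalk_fraction g.
  have [u eu] := unit_off_ker nb; exists (a * u).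
  by rewrite rmorphM /= -e -mulrA -rmorphM [b * u]mulrC eu rmorph1 mulr1.
have noeth0 := noetherian_surj noethR surj.
have ct0 : stalk_const P0 t <> 0.
  move=> /stalk_const_eq0[s [ns st]]; apply: t0.
  by have [u eu] := unit_off_ker ns; rewrite -(mul1r t) -eu -mulrA st mulr0.
have [I [iI colI [N IN]]] := separating_primary_ideal noeth0 max0 uniq0 ct0.
exists N => P hP; have -> : P = P0.
  by apply: spec_eq; apply/seteqP; split=> r /hP.
by exists I.
Qed.

End ResidueStalk.

Section Nonliftable.
Variables (k : fieldType) (A : comNzRingType) (iota : {rmorphism k -> A}).
Variables (R : comPzRingType) (pi : {rmorphism R -> k}).
Hypothesis augA : nil_augmented iota.
Hypothesis pi_surj : forall y, exists x, pi x = y.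

Definition Spec_over : sch_over (Spec k) := Over (Spec_map iota).

Variables (Xt : sch_over (Spec R)) (i : lr_mor Spec_over Xt).
Hypothesis immersion : closed_immersion i.
Hypothesis fiber : is_fiber_product i (structure Spec_over) (structure Xt) (Spec_map pi).
Variable x : spec A.

Let f : lr_mor Xt (Spec R) := structure Xt.
Let y : Xt := i x.
Let theta : {rmorphism stalk y -> stalk (x : spec_rs A)} := stalk_map i x.

Lemma lift_point r : (f y : spec R) r <-> pi r = 0.
Proof.
have [[pts _] _] := fiber.
have [P hP] := nil_augmented_point augA.
rewrite /f /y; have -> : structure Xt (i x) = spec_comap pi (spec_comap iota x) := pts x.
by rewrite (nil_augmented_spec_eq augA x P); exact: hP.
Qed.

Lemma lift_stalk_surj a : exists h, theta h = stalk_const x a.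
Proof.
have [_ _ surj] := immersion.
have [W [h [t [Wy _ e]]]] := surj (opensT Xt) (spec_const _ a) y Logic.I.
exists (germ Wy t).
have e1 := @stalk_map_res _ _ i x (i ^-1o opensT Xt) Logic.I W Wy h t _ e.
rewrite /theta /=; refine (etrans e1 _).
exact: (@germ_spec_const A (i ^-1o opensT Xt) x Logic.I).
Qed.

(** A section that vanishes in the stalk of the one-point scheme vanishes on all
    of it.  The test object maps to the fibre product, so the section vanishes
    there too. *)
Lemma lift_stalk_kernel h : theta h = 0 ->
  extension (stalk_map f y) (stalk_max (P := f y)) h.
Proof.
have [V [Vy [s ->]]] := germ_ex h.
rewrite /theta /= (stalk_mapE (f := i) Vy Vy s) -(germ_0 (Vy : (i ^-1o V) x)).
move=> /germP[W [hW [hW' [Wx e]]]].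
have {e} s0 : pull i V s = 0.
  rewrite rmorph0 in e; apply: (res_eq0 _ e) => x' _.
  by rewrite (nil_augmented_spec_eq augA x' x).
have [C [a [b [sq test]]]] := fiber_test pi_surj lift_point.
apply: test; have [_ univ] := fiber.
have [u [[pts e] _ _]] := univ (Spec C) a b sq.
have sub : lr_comp i u ^-1o V `<=` a ^-1o V by move=> t /=; rewrite -pts.
have sub' : a ^-1o V `<=` lr_comp i u ^-1o V by move=> t /=; rewrite -pts.
apply: (res_eq0 (h := sub) sub'); rewrite e.
have [h' ->] : exists h' : lr_comp i u ^-1o V `<=` u ^-1o (i ^-1o V),
    pull (lr_comp i u) V s = res h' (pull u (i ^-1o V) (pull i V s)).
  by eexists.
by rewrite s0 !rmorph0.
Qed.

(** The maximal ideal of the stalk of Spec R is generated by the kernel of pi,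
    and the square of the fibre product commutes. *)
Lemma lift_stalk_max r : stalk_max r -> theta (stalk_map f y r) = 0.
Proof.
have [a [b [nb e]]] := stalk_fraction (r : stalk (f y : spec_rs R)).
have [iM _ _] := proj1 (stalk_max_maximal (f y : spec R)).
move=> Mr; have fa : (f y : spec R) a.
  by apply/stalk_max_const; rewrite -e; exact: idealMr.
have [u eu] := stalk_const_unit nb.
apply: (fraction_eq0 (f := stalk_map f y) (g := theta) eu e).
have [sq _] := fiber.
have := eq_mor_pull_const (x : Spec A) a sq.
rewrite (pull_const_Spec_map_comp pi iota x a) (proj1 (lift_point a) fa) !rmorph0 => <-.
exact: (esym (pull_const_comp f i x a)).
Qed.

End Nonliftable.

(** N is the exponent of [residue_stalk_primary] for t = p. *)
Lemma defect_not_liftable (k : fieldType) (p : nat) (R : comPzRingType)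
    (pi : {rmorphism R -> k}) :
  prime p -> noetherian R -> local_ring R -> (forall y : k, exists x, pi x = y) ->
  p%:R != 0 :> R ->
  exists N, forall (A : comNzRingType) (iota : {rmorphism k -> A}) (L e : nat),
    nil_augmented iota -> (N <= L)%N -> (N <= p ^ e)%N ->
    defect_witness A p L (p ^ e) -> ~ liftable pi (Spec_over iota).
Proof.
move=> pr_p noethR localR pi_surj /eqP p0.
have [N HN] := residue_stalk_primary noethR localR pi_surj p0.
exists N => A iota L e augA NL Ne [a [b [c [abc la lb lc D]]]].
move=> [Xt [i [flat imm fib]]]; apply: D.
have [x _] := nil_augmented_point augA.
have [I [iI colI IN]] := HN _ (lift_point augA fib x).
have [[im _ _] _] := stalk_max_maximal (structure Xt (i x) : spec R).
have col r : I (p%:R * r) <-> stalk_max r.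
  by rewrite -colI rmorph_nat.
apply: (nil_augmented_stalk_inj augA (P := x)).
apply: (defect_obstruction pr_p (flat (i x)) im iI col IN
  (lift_stalk_surj imm x) (lift_stalk_kernel augA pi_surj fib (x := x))
  (lift_stalk_max augA fib (x := x)) NL Ne abc la lb lc).
Qed.

Theorem corollary4p9 (k : fieldType) (p : nat) (hp : p \in [pchar k]) :
  exists (X : nat -> sch_over (Spec k)) (t : forall n, lr_mor (X n) (X n.+1)),
    [/\ forall n, over_mor (t n),
        forall n, krull_dim (X n) 0 &
        forall (R : comPzRingType) (pi : {rmorphism R -> k}),
          noetherian R -> local_ring R -> (forall y : k, exists x : R, pi x = y) ->
          p%:R != 0 :> R ->
          exists N : nat, forall n : nat, (N <= n)%N -> ~ liftable pi (X n)].
Proof.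
have pr_p := pcharf_prime hp.
pose A n := projT1 (cid (defect_algebra n hp)).
pose iota n : {rmorphism k -> A n} := projT1 (cid (projT2 (cid (defect_algebra n hp)))).
have [aug wit] : (forall n, nil_augmented (iota n)) /\
    forall n, defect_witness (A n) p n.+1 (p ^ n.+1).
  by split=> n; have [] := projT2 (cid (projT2 (cid (defect_algebra n hp)))).
have eps n : {eps : {rmorphism A n -> k} | cancel (iota n) eps}.
  by apply: cid; have [eps epsK _] := augmentation (aug n); exists eps.
pose down n : {rmorphism A n.+1 -> A n} := iota n \o projT1 (eps n.+1).
exists (fun n => Spec_over (iota n)), (fun n => Spec_map (down n)); split.
(* both sides are determined by the scalars, and down n fixes them *)
- move=> n; apply: eq_mor_to_spec => P c.
  rewrite pull_const_Spec_map_comp pull_const_Spec_map; congr (stalk_const _ _).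
  by rewrite /down /= (projT2 (eps n.+1)).
- move=> n; have [P _] := nil_augmented_point (aug n).
  by apply: (one_point_krull_dim (x := P)) => Q; exact: nil_augmented_spec_eq (aug n) _ _.
- move=> R pi noethR localR pi_surj p0.
  have [N HN] := defect_not_liftable pr_p noethR localR pi_surj p0.
  exists N => n Nn; apply: (HN _ _ n.+1 n.+1) => //; first exact: leqW.
  by rewrite (leq_trans Nn) // ltnW // ltnW // ltn_expl // prime_gt1.
Qed.
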